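(* Let $K$ be a global field, let $S$ be a finite nonempty set of primes of $K$ (containing all the archimedean primes if $K$ is a number field), and let $A$ be the ring of $S$-integers of $K$. Let $k$ and $m$ be arbitrary positive integers. Let $r_1,r_2,\ldots,r_m$ be a sequence of elements of $A$ such that for every permutation $\sigma\in S_m$ the $m(m+1)/2$ sums $$\sum_{l=i}^{j} r_{\sigma(l)},\qquad 1\le i\le j\le m,$$ are distinct elements of $A$. Then there are infinitely many nonzero prime ideals $P$ of $A$ such that $r_1,r_2,\ldots,r_m$ is an $m$ term permutation chain of $k$th power residue modulo $P$.
   Context: A global field is an algebraic number field (finite extension of $\mathbb{Q}$) or an algebraic function field in one variable with a finite constant field. Primes of $K$ are its places. The ring of $S$-integers is $A=\{a\in K \mid \mathrm{ord}_P(a)\ge 0 \text{ for all primes } P\notin S\}$; it is a Dedekind domain. $S_m$ denotes the symmetric group on $\{1,\ldots,m\}$. Let $P$ be a nonzero prime ideal of $A$ and $k$ a positive integer. An element $a\in A$ is a $k$th power residue modulo $P$ if there is $b\in A$ with $a\equiv b^k \pmod P$ (so elements of $P$ count as $k$th power residues). A sequence $r_1,\ldots,r_m$ of elements of $A$ is a chain of $k$th power residue modulo $P$ if the $m(m+1)/2$ sums $\sum_{l=i}^{j} r_l$, $1\le i\le j\le m$, are all $k$th power residues modulo $P$ and are pairwise distinct modulo $P$. The sequence $r_1,\ldots,r_m$ is a permutation chain of $k$th power residue modulo $P$ if $r_{\sigma(1)},\ldots,r_{\sigma(m)}$ is a chain of $k$th power residue modulo $P$ for every permutation $\sigma\in S_m$.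 *)

(* Defs.v *)
From HB Require Import structures.
From mathcomp Require Import all_boot all_order all_fingroup all_algebra all_field.
From mathcomp Require Import ring_quotient.
From mathcomp Require Import all_classical all_reals exp.

Set Implicit Arguments.
Unset Strict Implicit.
Unset Printing Implicit Defensive.

Import Order.TTheory GRing.Theory Num.Theory.
Local Open Scope classical_set_scope.
Local Open Scope ring_scope.

Definition number_field (K : fieldType) : Prop :=
  exists (L : fieldExtType rat) (f : {rmorphism L -> K}), bijective f.

(* A finite extension of F(t), F finite.  The base field F need not be the full
   constant field, and K need not be separable over F(t). *)
Definition global_function_field (K : fieldType) : Prop :=
  exists (F : finFieldType) (L : fieldExtType {fraction {poly F}})
         (f : {rmorphism L -> K}), bijective f.

Definition global_field (K : fieldType) : Prop :=
  number_field K \/ global_function_field K.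

Section Places.
Variables (R : realType) (K : fieldType).
Implicit Types (u w : K -> R) (v : K -> int) (P : set (K -> R)).

Definition absolute_value u : Prop :=
  [/\ forall x, 0 <= u x,
      forall x, u x = 0 <-> x = 0,
      {morph u : x y / x * y} &
      forall x y, u (x + y) <= u x + u y].

Definition nontrivial u : Prop := exists2 x, x != 0 & u x != 1.

Definition nonarchimedean u : Prop :=
  forall x y, u (x + y) <= Num.max (u x) (u y).

Definition equivalent u w : Prop :=
  exists2 s : R, 0 < s & forall x, w x = u x `^ s.

(* A place is an equivalence class of nontrivial absolute values, represented
   as the set of its members. *)
Definition place P : Prop :=
  exists u, [/\ absolute_value u, nontrivial u &
                P = [set w | absolute_value w /\ equivalent u w]].

Definition archimedean P : Prop := exists2 u, P u & ~ nonarchimedean u.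

(* Only the values of v on K^* are meaningful: v 0 = 0 is a placeholder for
   the usual convention v 0 = +oo. *)
Definition normalized_valuation v : Prop :=
  [/\ v 0 = 0,
      forall x y, x != 0 -> y != 0 -> v (x * y) = v x + v y,
      forall x y, x != 0 -> y != 0 -> x + y != 0 ->
        Num.min (v x) (v y) <= v (x + y) &
      forall n : int, exists2 x, x != 0 & v x = n].

Definition induces v P : Prop :=
  exists2 c : R, 0 < c < 1 & P (fun x => if x == 0 then 0 else c ^ v x).

(* The normalized valuation attached to a nonarchimedean place of a global
   field.  It is constantly 0 if there is none (e.g. if P is archimedean). *)
Definition pord P : K -> int :=
  xget (fun=> 0) [set v | normalized_valuation v /\ induces v P].

Lemma pordP P : normalized_valuation (pord P) \/ pord P = (fun=> 0).
Proof.
rewrite /pord; case: xgetP => [v _ []|]; first by left.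
by right.
Qed.

Lemma pord0 P : pord P 0 = 0.
Proof. by case: (pordP P) => [[]|->]. Qed.

Lemma pordM P x y : x != 0 -> y != 0 -> pord P (x * y) = pord P x + pord P y.
Proof. by case: (pordP P) => [[_ h _ _]|->]; [exact: h|rewrite addr0]. Qed.

Lemma pord_ge0M P x y : 0 <= pord P x -> 0 <= pord P y -> 0 <= pord P (x * y).
Proof.
move=> hx hy.
have [->|x0] := eqVneq x 0; first by rewrite mul0r pord0.
have [->|y0] := eqVneq y 0; first by rewrite mulr0 pord0.
by rewrite pordM // addr_ge0.
Qed.

Lemma pord_ge0D P x y : 0 <= pord P x -> 0 <= pord P y -> 0 <= pord P (x + y).
Proof.
move=> hx hy.
have [->|x0] := eqVneq x 0; first by rewrite add0r.
have [->|y0] := eqVneq y 0; first by rewrite addr0.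
have [->|xy0] := eqVneq (x + y) 0; first by rewrite pord0.
case: (pordP P) => [[_ _ h _]|-> //].
by apply: le_trans (h _ _ x0 y0 xy0); rewrite le_min hx hy.
Qed.

Lemma pord1 P : pord P 1 = 0.
Proof.
have := @pordM P 1 1 (oner_neq0 _) (oner_neq0 _).
by rewrite mulr1 -[X in X = _]addr0 => /addrI.
Qed.

Lemma pordN1 P : pord P (-1) = 0.
Proof.
have n10 : (-1 : K) != 0 by rewrite oppr_eq0 oner_neq0.
have := pordM P n10 n10.
rewrite mulrNN mulr1 pord1 -mulr2n => /esym/eqP.
by rewrite mulrn_eq0 => /eqP.
Qed.

Definition S_integer (S : set (set (K -> R))) : {pred K} :=
  fun a => `[< forall P, place P -> ~ S P -> 0 <= pord P a >].

Lemma S_integer_subring_closed S : subring_closed (S_integer S).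
Proof.
split.
- by apply/asboolP => P _ _; rewrite pord1.
- move=> x y /asboolP hx /asboolP hy; apply/asboolP => P pP SP.
  apply: pord_ge0D; first exact: hx.
  by rewrite -mulN1r; apply: pord_ge0M; [rewrite pordN1|exact: hy].
- move=> x y /asboolP hx /asboolP hy; apply/asboolP => P pP SP.
  by apply: pord_ge0M; [exact: hx|exact: hy].
Qed.

HB.instance Definition _ S := GRing.isSubringClosed.Build K (S_integer S)
  (S_integer_subring_closed S).

Record S_integers (S : set (set (K -> R))) : Type :=
  SInteger { S_integer_val : K; _ : S_integer_val \in S_integer S }.

HB.instance Definition _ S := [isSub for @S_integer_val S].
HB.instance Definition _ S := [Choice of S_integers S by <:].
HB.instance Definition _ S := [SubChoice_isSubComNzRing of S_integers S by <:].

End Places.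

Section Chains.
Variable A : comNzRingType.
Implicit Types (P : set A) (a : A).

Definition nonzero_prime_ideal P : Prop :=
  [/\ idealr_closed [in P], prime_idealr_closed [in P] & P <> [set 0]].

Definition kth_power_residue P (k : nat) a : Prop :=
  exists b : A, P (a - b ^+ k).

Definition segment_sum (m : nat) (r : 'I_m -> A) (i j : 'I_m) : A :=
  \sum_(l < m | (i <= l <= j)%N) r l.

Definition residue_chain P (k m : nat) (r : 'I_m -> A) : Prop :=
  (forall i j : 'I_m, (i <= j)%N ->
     kth_power_residue P k (segment_sum r i j)) /\
  (forall i j i' j' : 'I_m, (i <= j)%N -> (i' <= j')%N ->
     P (segment_sum r i j - segment_sum r i' j') -> (i, j) = (i', j')).

Definition permutation_chain P (k m : nat) (r : 'I_m -> A) : Prop :=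
  forall s : 'S_m, residue_chain P k (r \o s).

End Chains.

(* Main.v *)
From HB Require Import structures.
Require Import Defs.
From mathcomp Require Import all_boot all_order all_fingroup all_algebra all_field.
From mathcomp Require Import all_classical all_reals exp.
From mathcomp Require Import ring lra zify.

Set Implicit Arguments.
Unset Strict Implicit.
Unset Printing Implicit Defensive.

Import Order.TTheory GRing.Theory Num.Theory.
Local Open Scope classical_set_scope.
Local Open Scope ring_scope.

(** Idea of the proof.  Let a_1, ..., a_l be the finitely many segment sums of
    all rearrangements of r, and let D be the ring Z when K is a number field,
    and F[x], with x a nonconstant S-integer, when K is a function field.  Then
    D is a Euclidean ring with finite residue rings, contained in the ring of
    S-integers, and K is finite over the fraction field k0 of D.  Adjoin to K
    a k-th root beta_i of each a_i, obtaining a finite extension M of k0.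

    It suffices to find a discrete valuation v of M at which each beta_i is
    congruent to an element b_i of D.  Then a_i is congruent to b_i ^ k, and
    the S-integers of positive value form a prime ideal as long as the place of
    K below v is not in S.  Asking in addition that the inverses of the nonzero
    differences a_i - a_j be congruent to elements of D keeps the a_i distinct,
    and asking that v vanish at a given nonzero m in D makes it possible to
    avoid any finite set of places and of prime ideals.  Such a v is given by
    [residue_degree_one_valuation], as follows.

    Some power y -> y ^ Q of the Frobenius (Q = 1 in characteristic 0) maps M
    to a separable subextension k0(z).  Let f in D[X] be a multiple of the
    minimal polynomial of z.  As in the argument of Euclid and Schur, the
    values of f at elements of D are divisible by infinitely many primes pi
    ([maximal_dividing_value]).  If pi divides f(a) and avoids a finite number
    of primes, then a is a simple root of f modulo pi, and the fractions
    g(z) / h(z) with h(a) prime to pi form a discrete valuation ring with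
    uniformizer pi and residue field D / pi: this is Hensel's lemma in
    disguise.  Its valuation, composed with y -> y ^ Q, is a valuation of M.
    The finite field D / pi is perfect, so the residue of y ^ Q is the Q-th
    power of some b in D, and y is then congruent to b.

    For a function field there remains to find x.  Let P be a place in S and y
    an element with a pole at P.  A counting argument, which is a weak form of
    the Riemann-Roch theorem, gives a nonconstant x without poles outside P
    ([exists_pole_only_at]): the functions y * (polynomial in y of degree less
    than N) * (basis of K integral over F[y]) span a space of dimension n N
    over F, where n = [K : F(y)], and regularity at all the places at infinity
    other than P imposes at most (n - 1) N + O(1) conditions.  Finally K is
    finite over F(x) because x is transcendental over F
    ([finite_over_transcendental]). *)

(** * Maximal elements of Euclidean rings *)

Definition divides (D : comNzRingType) (a b : D) := exists c, b = c * a.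

Section Divides.
Variable D : comNzRingType.
Implicit Types a b c : D.

Lemma divides0 a : divides a 0. Proof. by exists 0; rewrite mul0r. Qed.
Lemma dividesrr a : divides a a. Proof. by exists 1; rewrite mul1r. Qed.
Lemma dividesMl c a b : divides a b -> divides a (c * b).
Proof. by case=> d ->; exists (c * d); rewrite mulrA. Qed.
Lemma dividesMr c a b : divides a b -> divides a (b * c).
Proof. by rewrite mulrC; exact: dividesMl. Qed.
Lemma dividesD a b c : divides a b -> divides a c -> divides a (b + c).
Proof. by case=> d -> [e ->]; exists (d + e); rewrite mulrDl. Qed.
Lemma dividesN a b : divides a b -> divides a (- b).
Proof. by case=> d ->; exists (- d); rewrite mulNr. Qed.
Lemma dividesB a b c : divides a b -> divides a c -> divides a (b - c).
Proof. by move=> h1 h2; apply: dividesD => //; apply: dividesN. Qed.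
Lemma divides_trans b a c : divides a b -> divides b c -> divides a c.
Proof. by case=> d -> [e ->]; exists (e * d); rewrite mulrA. Qed.
Lemma divides_horner_sub (f : {poly D}) a b : divides (a - b) (f.[a] - f.[b]).
Proof.
have /factor_theorem[q Eq]: root (f - f.[b]%:P) b.
  by rewrite /root hornerD hornerN hornerC subrr.
by exists q.[a]; have /(congr1 (horner^~ a)) := Eq; rewrite !hornerE.
Qed.

Definition maximal_elt (pi : D) :=
  ~ divides pi 1 /\ (forall a, ~ divides pi a -> exists b, divides pi (a * b - 1)).

Lemma maximal_prime pi a b :
  maximal_elt pi -> divides pi (a * b) -> divides pi a \/ divides pi b.
Proof.
move=> [_ H] hab; have [ha|/H[c hc]] := pselect (divides pi a); [by left|right].
have -> : b = a * b * c - (a * c - 1) * b by ring.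
by apply: dividesB; apply: dividesMr.
Qed.

Lemma maximal_prime_exp pi a n :
  maximal_elt pi -> divides pi (a ^+ n) -> divides pi a.
Proof.
move=> mpi; elim: n => [|n IHn]; first by rewrite expr0; case: mpi.
by rewrite exprS => /(maximal_prime mpi)[].
Qed.
End Divides.

Record euclidean_norm (D : idomainType) (N : D -> nat) : Prop := EuclideanNorm {
  norm_div : forall a b, b != 0 ->
    exists q r, a = q * b + r /\ (r = 0 \/ (N r < N b)%N);
  norm_mul : forall a b, a != 0 -> b != 0 -> (N b <= N (a * b)%R)%N;
  norm_mul_nonunit : forall a b, a != 0 -> b != 0 -> a \isn't a GRing.unit ->
    (N b < N (a * b)%R)%N;
  norm_ball_finite : forall n, exists s : seq D, forall d, (N d < n)%N -> d \in s;
  norm_infinite : forall s : seq D, exists d, d \notin s }.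

Section Euclid.
Variables (D : idomainType) (N : D -> nat).
Hypothesis normN : euclidean_norm N.
Implicit Types (a b d pi : D).

Lemma norm_min (P : D -> Prop) : (exists d, P d) ->
  exists2 d, P d & forall e, P e -> (N d <= N e)%N.
Proof.
case=> d0 Pd0.
have exn : exists n, `[< exists2 d, P d & N d = n >].
  by exists (N d0); apply/asboolP; exists d0.
case: (ex_minnP exn) => n /asboolP[d Pd Nd] nmin.
by exists d => // e Pe; rewrite Nd; apply: nmin; apply/asboolP; exists e.
Qed.

Lemma unit_divides1 d : divides d 1 <-> d \is a GRing.unit.
Proof.
split=> [[c]|dU]; last by exists d^-1; rewrite mulVr.
by move=> E; apply/unitrP; exists c; rewrite [d * c]mulrC -E.
Qed.

(** A nonunit divisor of least norm works: the ideal that it generates with an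
    element it does not divide is principal, and a generator divides it
    properly, so this generator has a smaller norm and must be a unit. *)
Lemma exists_maximal_divisor d : d != 0 -> d \isn't a GRing.unit ->
  exists2 pi, maximal_elt pi & divides pi d.
Proof.
move=> d0 dU.
pose P e := [/\ e != 0, e \isn't a GRing.unit & divides e d].
have [|pi [pi0 piU pid] pimin] := @norm_min P.
  by exists d; split => //; exact: dividesrr.
exists pi => //; split; first by move/unit_divides1; apply/negP.
move=> a npia.
pose I e := e != 0 /\ exists x y, e = x * a + y * pi.
have [|g [g0 [x [y gE]]] gmin] := @norm_min I.
  by exists pi; split => //; exists 0, 1; ring.
have gdiv e : (exists x y, e = x * a + y * pi) -> divides g e.
  move=> [x' [y' eE]]; have [q [r [E rlt]]] := norm_div normN e g0.
  have rI : exists x y, r = x * a + y * pi.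
    by exists (x' - q * x), (y' - q * y); have -> : r = e - q * g;
      [rewrite E; ring | rewrite gE eE; ring].
  have [r0|r0] := eqVneq r 0; first by exists q; rewrite E r0 addr0.
  case: rlt => [/eqP|]; first by rewrite (negPf r0).
  by rewrite ltnNge gmin.
have ga : divides g a by apply: gdiv; exists 1, 0; ring.
have gpi : divides g pi by apply: gdiv; exists 0, 1; ring.
have [/unit_divides1[c Ec]|gU] := boolP (g \is a GRing.unit).
  exists (c * x); exists (- c * y).
  by rewrite {1}Ec gE; ring.
case: npia; case: gpi => c Ec.
have [cU|cU] := boolP (c \is a GRing.unit).
  apply: (divides_trans _ ga); exists c^-1; rewrite Ec.
  by rewrite mulrA mulVr // mul1r.
have c0 : c != 0 by apply: contra_neq pi0; rewrite Ec => ->; rewrite mul0r.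
have Pg : P g.
  by split=> //; apply: (divides_trans _ pid); exists c.
have := norm_mul_nonunit normN c0 g0 cU; rewrite -Ec => h.
by have := pimin _ Pg; rewrite leqNgt h.
Qed.

Lemma maximal_nonunit pi : maximal_elt pi -> pi \isn't a GRing.unit.
Proof. by case=> h _; apply/negP => /unit_divides1. Qed.

Lemma factor_out pi d : maximal_elt pi -> d != 0 ->
  exists n d', d = pi ^+ n * d' /\ ~ divides pi d'.
Proof.
move=> mpi; have [n] := ubnP (N d); elim: n d => // n IHn d Nd d0.
have [[c dE]|] := pselect (divides pi d); last first.
  by move=> h; exists 0%N, d; split => //; rewrite mul1r.
have c0 : c != 0 by apply: contra_neq d0; rewrite dE => ->; rewrite mul0r.
have pi0 : pi != 0 by apply: contra_neq d0; rewrite dE => ->; rewrite mulr0.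
have [||k [d' [cE nd']]] := IHn c => //.
  apply: leq_trans (_ : N d <= _)%N; last by rewrite -ltnS.
  by rewrite dE mulrC; apply: norm_mul_nonunit => //; exact: maximal_nonunit.
by exists k.+1, d'; split => //; rewrite dE cE exprS; ring.
Qed.

Lemma infinite_uniq n : exists s : seq D, uniq s /\ size s = n.
Proof.
elim: n => [|n [s [us ss]]]; first by exists [::].
have [d ds] := norm_infinite normN s.
by exists (d :: s); rewrite /= ds us ss.
Qed.

Lemma poly_nonroot (p : {poly D}) : p != 0 -> exists d, ~~ root p d.
Proof.
move=> p0; have [s [us ss]] := infinite_uniq (size p).
have [/(max_poly_roots p0)/(_ us)|] := boolP (all (root p) s).
  by rewrite ss ltnn.
by case/allPn => d _ nd; exists d.
Qed.

Lemma residues_collide pi (c : nat -> D) : pi != 0 ->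
  exists i j, (i < j)%N /\ divides pi (c i - c j).
Proof.
move=> pi0.
have [s sP] := norm_ball_finite normN (N pi).
have /choice[r rP] : forall i, exists r, r \in 0 :: s /\ divides pi (c i - r).
  move=> i; have [q [r [E rlt]]] := norm_div normN (c i) pi0.
  exists r; split; last by exists q; rewrite E; ring.
  by rewrite inE; case: rlt => [->|/sP->]; rewrite ?eqxx ?orbT.
pose t := [seq r i | i <- iota 0 (size s).+2].
have : ~~ uniq t.
  apply/negP => ut.
  have : (size t <= size (0%R :: s))%N.
    by apply: uniq_leq_size ut _ => x /mapP[i _ ->]; case: (rP i).
  by rewrite size_map size_iota /= ltnn.
case/(uniqPn 0) => i [j [ij]]; rewrite size_map size_iota => jt.
rewrite !(nth_map 0%N) ?size_iota ?(ltn_trans ij) //.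
rewrite !nth_iota ?(ltn_trans ij) // !add0n => E.
exists i, j; split => //; have -> : c i - c j = (c i - r i) - (c j - r j).
  by rewrite E; ring.
by apply: dividesB; [case: (rP i)|case: (rP j)].
Qed.

(** Two terms of the sequence c ^ (Q ^ i) collide modulo [pi], because D / pi is
    finite; taking the (Q ^ i)-th root of the collision, which is allowed since
    this power is additive, shows that c is a Q-th power. *)
Lemma residue_field_perfect pi Q c : maximal_elt pi -> pi != 0 ->
  (forall x y : D, (x + y) ^+ Q = x ^+ Q + y ^+ Q) ->
  exists b, divides pi (b ^+ Q - c).
Proof.
move=> mpi pi0 addQ.
have Q0 : (0 < Q)%N.
  case: Q addQ => // /(_ 0 0) /eqP; rewrite addr0 expr0.
  by rewrite -subr_eq0 opprD addrA subrr add0r oppr_eq0 oner_eq0.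
have subQ (x y : D) : (x - y) ^+ Q = x ^+ Q - y ^+ Q.
  by rewrite -{2}(subrK y x) [in RHS]addQ addrK.
have subQn i (x y : D) : (x - y) ^+ (Q ^ i) = x ^+ (Q ^ i) - y ^+ (Q ^ i).
  elim: i x y => [|i IHi] x y; first by rewrite expn0 !expr1.
  by rewrite expnSr !exprM IHi subQ.
have [i [j [ij]]] := residues_collide (fun i => c ^+ (Q ^ i)) pi0.
have -> : (Q ^ j = Q ^ (j - i.+1) * Q * Q ^ i)%N.
  by rewrite -expnSr -expnD; congr expn; lia.
rewrite exprM -subQn => /(maximal_prime_exp mpi) h.
by exists (c ^+ (Q ^ (j - i.+1))); rewrite -exprM -opprB; apply: dividesN.
Qed.

Lemma norm_units_finite : exists s : seq D, forall d, d \is a GRing.unit -> d \in s.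
Proof.
have [s sP] := norm_ball_finite normN (N 1).+1.
exists s => d dU; apply: sP; rewrite ltnS -(mulVr dU); apply: norm_mul => //.
  by rewrite invr_eq0; apply: contraTneq dU => ->; rewrite unitr0.
by apply: contraTneq dU => ->; rewrite unitr0.
Qed.

(** Euclid's argument, in the form due to Schur: if c0 = f(a0) is nonzero, then
    f(a0 + c0 m d) = c0 (1 + m k) for some k, and the second factor is prime to
    m.  As D is infinite and its units are finitely many, this factor is a
    nonzero nonunit for a suitable d. *)
Lemma maximal_dividing_value (f : {poly D}) m : (1 < size f)%N -> m != 0 ->
  exists pi a, [/\ maximal_elt pi, pi != 0, ~ divides pi m & divides pi f.[a]].
Proof.
move=> f1 m0.
have f0 : f != 0 by rewrite -size_poly_gt0 ltnW.
have [a0 na0] := poly_nonroot f0; set c0 := f.[a0] in na0 *.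
have c00 : c0 != 0 by [].
have [s sP] := norm_units_finite.
(* The roots of the composite of G and h are the d for which 1 + m k is zero
   or a unit. *)
pose G := \prod_(u <- 0 :: s) (f - (c0 * u)%:P).
pose h := (c0 * m) *: 'X + a0%:P.
have sh : size h = 2.
  rewrite size_polyDl size_scale ?mulf_neq0 ?size_polyX //.
  by rewrite ltnS size_polyC leq_b1.
have G0 : G \Po h != 0.
  rewrite -size_poly_gt0 size_comp_poly2 // size_poly_gt0 /G.
  rewrite prodf_seq_neq0; apply/allP => u _ /=.
  rewrite subr_eq0; apply: contraTneq f1 => ->.
  by rewrite size_polyC -leqNgt leq_b1.
have [d nd] := poly_nonroot G0.
set a := h.[d].
have [k kE] : divides (c0 * m) (f.[a] - f.[a0]).
  apply: divides_trans (divides_horner_sub _ _ _).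
  by exists d; rewrite /a /h hornerD hornerZ hornerX hornerC; ring.
pose e := 1 + m * k.
have faE : f.[a] = c0 * e.
  by move/eqP: kE; rewrite subr_eq => /eqP ->; rewrite -/c0 /e; ring.
have neq u : u \in 0 :: s -> e != u.
  move=> us; apply: contraNneq nd => eu.
  rewrite rootE horner_comp -/a horner_prod prodf_seq_eq0.
  by apply/hasP; exists u => //=; rewrite !hornerE faE eu subrr.
have e0 : e != 0 by apply: neq; rewrite inE eqxx.
have eU : e \isn't a GRing.unit.
  by apply/negP => /sP es; have := neq e; rewrite inE es orbT eqxx => /(_ isT).
have [pi mpi pie] := exists_maximal_divisor e0 eU.
exists pi, a; split=> //.
- by apply: contra_neq e0 => pi0; case: pie => c; rewrite pi0 mulr0.
- move=> pim; case: mpi => + _; apply.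
  have -> : 1 = e - m * k by rewrite /e; ring.
  by apply: dividesB => //; apply: dividesMr.
- by rewrite faE; apply: dividesMl.
Qed.

End Euclid.

(** * The local ring at a simple root modulo a prime *)

(** Over the fraction field of D, f is proportional to the minimal polynomial
    of z: it has the root z, and no nonzero polynomial of smaller degree has
    ([sr_min]).  The ring D[z] is then closed under inverses up to
    denominators in D ([sr_inv]).  The last field says that f'(z) divides in
    D[z] an element of D prime to pi; with [sr_root_mod] it makes a a simple
    root of f modulo pi. *)
Record simple_reduction (D : idomainType) (M : fieldType) (i : {rmorphism D -> M})
    (z : M) (f : {poly D}) (pi a : D) : Prop := SimpleReduction {
  sr_inj : injective i;
  sr_root : (map_poly i f).[z] = 0;
  sr_min : forall r : {poly D},
    (size r < size f)%N -> (map_poly i r).[z] = 0 -> r = 0;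
  sr_inv : forall w : {poly D}, (map_poly i w).[z] != 0 ->
    exists w' d, d != 0 /\ (map_poly i w).[z] * (map_poly i w').[z] = i d;
  sr_maximal : maximal_elt pi;
  sr_neq0 : pi != 0;
  sr_lead : ~ divides pi (lead_coef f);
  sr_root_mod : divides pi f.[a];
  sr_different : exists w' d,
    ~ divides pi d /\ (map_poly i f^`()).[z] * (map_poly i w').[z] = i d }.

Section LocalRing.
Variables (D : idomainType) (M : fieldType) (i : {rmorphism D -> M}).
Variables (z : M) (f : {poly D}) (pi a : D).
Hypothesis red : simple_reduction i z f pi a.
Let ev (g : {poly D}) : M := (map_poly i g).[z].
Let i_inj := sr_inj red.
Let fz : ev f = 0 := sr_root red.
Let mpi := sr_maximal red.
Let pi0 := sr_neq0 red.
Let pi_lead := sr_lead red.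

Let evD g h : ev (g + h) = ev g + ev h.
Proof. by rewrite /ev rmorphD hornerD. Qed.
Let evB g h : ev (g - h) = ev g - ev h.
Proof. by rewrite /ev rmorphB hornerD hornerN. Qed.
Let evM g h : ev (g * h) = ev g * ev h.
Proof. by rewrite /ev rmorphM hornerM. Qed.
Let evC d : ev d%:P = i d.
Proof. by rewrite /ev map_polyC hornerC. Qed.
Let ev1 : ev 1 = 1.
Proof. by rewrite /ev rmorph1 hornerC. Qed.
Let evX : ev 'X = z.
Proof. by rewrite /ev map_polyX hornerX. Qed.

(** Evaluation at a modulo pi is well defined on D[z]: f divides g up to a power
    of its leading coefficient, which is prime to pi, and pi divides f(a). *)
Lemma divides_of_ev0 g : ev g = 0 -> divides pi g.[a].
Proof.
move=> g0.
have f0 : f != 0.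
  by apply/negP => /eqP f0; apply: pi_lead; rewrite f0 lead_coef0; exact: divides0.
have E := Pdiv.Idomain.divp_eq g f.
have r0 : g %% f = 0.
  apply: (sr_min red); first by rewrite Pdiv.Idomain.ltn_modp.
  have /(congr1 ev) := E; rewrite -mul_polyC evD !evM g0 fz !mulr0 add0r.
  by rewrite /ev => <-.
have /(congr1 (horner^~ a)) := E; rewrite r0 addr0.
rewrite hornerZ hornerM => Ea.
have : divides pi (lead_coef f ^+ scalp g f * g.[a]).
  by rewrite Ea; apply: dividesMl; exact: sr_root_mod red.
by case/(maximal_prime mpi) => // /(maximal_prime_exp mpi).
Qed.

Lemma ev_neq0 h : ~ divides pi h.[a] -> ev h != 0.
Proof. by move=> nh; apply/eqP => /divides_of_ev0. Qed.

Let pi_simple : ~ divides pi f^`().[a].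
Proof.
have [w' [d [nd E]]] := sr_different red; move=> h; apply: nd.
have : ev (f^`() * w' - d%:P) = 0 by rewrite evB evM evC E subrr.
move/divides_of_ev0; rewrite hornerD hornerM hornerN hornerC => h'.
rewrite -(subKr (f^`().[a] * w'.[a]) d); apply: dividesB => //.
exact: dividesMr.
Qed.

Definition loc (y : M) := exists g h, ~ divides pi h.[a] /\ y * ev h = ev g.
Definition loc_unit (y : M) :=
  exists g h, [/\ ~ divides pi g.[a], ~ divides pi h.[a] & y * ev h = ev g].

Let ndivM b c : ~ divides pi b -> ~ divides pi c -> ~ divides pi (b * c).
Proof. by move=> h1 h2 /(maximal_prime mpi)[]. Qed.
Let ndiv1 : ~ divides pi (1 : {poly D}).[a].
Proof. by rewrite hornerC; case: mpi. Qed.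

Lemma loc_ev g : loc (ev g).
Proof. by exists g, 1; split => //; rewrite ev1 mulr1. Qed.

Lemma locM x y : loc x -> loc y -> loc (x * y).
Proof.
move=> [g [h [nh E]]] [g' [h' [nh' E']]]; exists (g * g'), (h * h').
by split; [rewrite hornerM; exact: ndivM | rewrite !evM -E -E'; ring].
Qed.

Lemma locD x y : loc x -> loc y -> loc (x + y).
Proof.
move=> [g [h [nh E]]] [g' [h' [nh' E']]]; exists (g * h' + g' * h), (h * h').
by split; [rewrite hornerM; exact: ndivM | rewrite evD !evM -E -E'; ring].
Qed.

Lemma loc_unit_loc x : loc_unit x -> loc x.
Proof. by move=> [g [h [_ nh E]]]; exists g, h. Qed.

Lemma loc_unit_neq0 x : loc_unit x -> x != 0.
Proof.
move=> [g [h [/ev_neq0 ng nh E]]]; apply: contraNneq ng => x0.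
by rewrite -E x0 mul0r.
Qed.

Lemma loc_unit_coef d : ~ divides pi d -> loc_unit (i d).
Proof.
by move=> nd; exists d%:P, 1; split; [rewrite hornerC|exact: ndiv1|rewrite ev1 mulr1 evC].
Qed.

Lemma loc_unitM x y : loc_unit x -> loc_unit y -> loc_unit (x * y).
Proof.
move=> [g [h [ng nh E]]] [g' [h' [ng' nh' E']]]; exists (g * g'), (h * h').
by split; rewrite ?hornerM; [exact: ndivM..|rewrite !evM -E -E'; ring].
Qed.

Lemma loc_unitV x : loc_unit x -> loc_unit x^-1.
Proof.
move=> xU; have x0 := loc_unit_neq0 xU.
move: xU => [g [h [ng nh E]]]; exists h, g; split => //.
by rewrite -E mulKf.
Qed.

(** The maximal ideal of the local ring is generated by pi.  Since g(z) is
    congruent to g(a) modulo z - a, only z - a has to be considered, and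
    f(z) = 0 reads (z - a) f1(z) = - f(a), where f1(z) is a unit because
    f1(a) = f'(a). *)
Lemma ev_multiple g : divides pi g.[a] ->
  exists2 y, loc y & ev g = i pi * y.
Proof.
move=> [t' Eg]; have [t Ef] := sr_root_mod red.
have xdvd (h : {poly D}) : exists q, h = q * ('X - a%:P) + h.[a]%:P.
  have /factor_theorem[q Eq] : root (h - h.[a]%:P) a.
    by rewrite /root hornerD hornerN hornerC subrr.
  by exists q; rewrite -Eq subrK.
have [f1 E1] := xdvd f; have [g1 E2] := xdvd g.
have f1a : f1.[a] = f^`().[a].
  by rewrite E1 !derivE !(hornerD, hornerN, hornerM, hornerC, hornerX, hornerZ); ring.
have nf1 : ~ divides pi f1.[a] by rewrite f1a.
exists (ev (t'%:P * f1 - t%:P * g1) / ev f1).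
  by exists (t'%:P * f1 - t%:P * g1), f1; split => //; rewrite divfK // ev_neq0.
have zf : ev f1 * (z - i a) = - (i pi * i t).
  have := fz; rewrite E1 evD evM evB evX !evC Ef rmorphM => /eqP.
  by rewrite addr_eq0 => /eqP ->; rewrite mulrC.
have nz := ev_neq0 nf1.
apply: (mulIf nz); rewrite -mulrA divfK // {1}E2 evD evM evB evX evC Eg.
rewrite mulrDl [ev g1 * _ * _](_ : _ = ev g1 * (ev f1 * (z - i a))); last by ring.
by rewrite zf evB !evM !evC rmorphM; ring.
Qed.

Lemma loc_split y : loc y -> loc_unit y \/ exists2 y', loc y' & y = i pi * y'.
Proof.
move=> [g [h [nh E]]]; have [/ev_multiple[y' ly' Eg]|ng] := pselect (divides pi g.[a]);
  last by left; exists g, h.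
right; exists (y' / ev h).
  apply: locM => //; apply/loc_unit_loc/loc_unitV.
  by exists h, 1; split=> //; rewrite ev1 mulr1.
by rewrite mulrA -Eg -E mulfK // ev_neq0.
Qed.

Lemma multiple_not_unit y : loc y -> ~ loc_unit (i pi * y).
Proof.
move=> [g [h [nh E]]] [g' [h' [ng' nh' E']]].
have : ev (pi%:P * g * h' - g' * h) = 0.
  by rewrite evB !evM evC -E -E'; ring.
move/divides_of_ev0; rewrite hornerD hornerN !hornerM hornerC => dv.
have : divides pi (g'.[a] * h.[a]).
  rewrite -[X in divides _ X](subKr (pi * g.[a] * h'.[a])).
  by apply: dividesB => //; do 2 apply: dividesMr; exact: dividesrr.
by apply: ndivM.
Qed.

Let ipi0 : i pi != 0.
Proof. by rewrite -(rmorph0 i) (inj_eq i_inj). Qed.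

Lemma multiple_exp_not_unit n y : (0 < n)%N -> loc y -> ~ loc_unit (i pi ^+ n * y).
Proof.
case: n => // n _ ly; rewrite exprS -mulrA; apply: multiple_not_unit.
by apply: locM => //; rewrite -rmorphXn -evC; exact: loc_ev.
Qed.

Definition ord (y : M) (n : int) := exists2 e, loc_unit e & y = i pi ^ n * e.

Variable N : D -> nat.
Hypothesis normN : euclidean_norm N.

(** Dividing g(z) by pi must stop: g(z) divides in D[z] a nonzero element d of
    D, which is pi ^ k times an element prime to pi, and a quotient of g(z) by
    pi ^ (k + 1) would make that element a nonunit. *)
Lemma ord_ev g : ev g != 0 -> exists n : nat, ord (ev g) n.
Proof.
move=> g0; have [w' [d [d0 Ed]]] : exists w' d, d != 0 /\ ev g * ev w' = i d.
  exact: (sr_inv red g0).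
have [k [d' [Edk nd']]] := factor_out normN mpi d0.
have [//|nord] := pselect (exists n : nat, ord (ev g) n).
have step j : exists2 y, loc y & ev g = i pi ^+ j * y.
  elim: j => [|j [y ly Ey]]; first by exists (ev g); [exact: loc_ev|rewrite mul1r].
  have [uy|[y' ly' Ey']] := loc_split ly; first by case: nord; exists j, y.
  by exists y' => //; rewrite Ey Ey' exprSr mulrA.
have [y ly Ey] := step k.+1.
have : loc_unit (i pi * (y * ev w')).
  suff -> : i pi * (y * ev w') = i d' by exact: loc_unit_coef.
  have pk0 : i pi ^+ k != 0 by rewrite expf_neq0.
  by apply: (mulfI pk0); rewrite -rmorphXn -rmorphM -Edk -Ed Ey exprSr rmorphXn; ring.
by move/multiple_not_unit; case; apply: locM => //; exact: loc_ev.
Qed.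

Lemma ordM x y n m : ord x n -> ord y m -> ord (x * y) (n + m).
Proof.
move=> [e ue ->] [e' ue' ->]; exists (e * e'); first exact: loc_unitM.
by rewrite expfzDr //; ring.
Qed.

Lemma ordV x n : ord x n -> ord x^-1 (- n).
Proof.
move=> [e ue ->]; exists e^-1; first exact: loc_unitV.
by rewrite invfM invr_expz.
Qed.

Lemma ord_quotient y w d : y != 0 -> d != 0 -> y * i d = ev w -> exists n, ord y n.
Proof.
move=> y0 d0 E; have id0 : i d != 0 by rewrite -(rmorph0 i) (inj_eq i_inj).
have [|n on] := @ord_ev w; first by rewrite -E mulf_neq0.
have [|m om] := @ord_ev d%:P; first by rewrite evC.
exists (n%:Z - m%:Z); rewrite -(mulfK id0 y) E.
by apply: ordM => //; apply: ordV; rewrite -evC.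
Qed.

Lemma ord_loc x (n : int) : 0 <= n -> ord x n -> loc x.
Proof.
case: n => // n _ [e ue ->]; rewrite -exprnP.
by apply: locM; [rewrite -rmorphXn -evC; exact: loc_ev|exact: loc_unit_loc].
Qed.

Lemma loc_ord x y n m : loc x -> y = i pi ^ m * x -> ord y n -> m <= n.
Proof.
move=> lx -> [e ue E]; rewrite leNgt; apply/negP => nm.
have mE : m = n + (`|m - n|)%N%:Z by rewrite gez0_abs; lia.
have : loc_unit (i pi ^+ `|m - n|%N * x).
  suff -> : i pi ^+ `|m - n|%N * x = e by [].
  have pn0 : i pi ^ n != 0 by rewrite expfz_neq0.
  by apply: (mulfI pn0); rewrite -E {2}mE expfzDr // mulrA.
by apply: multiple_exp_not_unit => //; rewrite absz_gt0 subr_eq0 gt_eqF.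
Qed.

Lemma ord_le x n m : ord x n -> ord x m -> n <= m.
Proof. by move=> [e /loc_unit_loc le Ex]; exact: loc_ord le Ex. Qed.

Lemma ord_uniq x n m : ord x n -> ord x m -> n = m.
Proof. by move=> h h'; apply/eqP; rewrite eq_le !(@ord_le x). Qed.

Lemma ordD x y n m l : ord x n -> ord y m -> ord (x + y) l -> Num.min n m <= l.
Proof.
wlog nm : x y n m / n <= m => [H|] ox oy oxy.
  have [nm|/ltW mn] := leP n m; first by have := H x y n m nm ox oy oxy; rewrite min_l.
  by have := H y x m n mn oy ox; rewrite addrC min_l //; exact.
rewrite min_l //; move: ox oy => [e ue Ex] [e' ue' Ey].
have mE : m = n + (`|m - n|)%N%:Z by rewrite gez0_abs; lia.
apply: (@loc_ord (e + i pi ^+ `|m - n|%N * e')) oxy.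
  apply: locD; first exact: loc_unit_loc.
  by apply: (@ord_loc _ `|m - n|%N) => //; exists e'.
by rewrite Ex Ey {1}mE expfzDr // -exprnP; ring.
Qed.

Lemma ord_coef d : d != 0 -> exists2 n : int, ord (i d) n & 0 <= n.
Proof.
move=> d0; have [|n on] := @ord_ev d%:P.
  by rewrite evC -(rmorph0 i) (inj_eq i_inj).
by exists n => //; rewrite -evC.
Qed.

Lemma ord_residue y w d : ~ divides pi d -> y * i d = ev w ->
  exists c, loc ((y - i c) / i pi).
Proof.
move=> nd E; have [_ /(_ d nd)[b db]] := mpi.
exists (w.[a] * b); have [|x lx Ex] := @ev_multiple (w - (w.[a] * b * d)%:P).
  rewrite hornerD hornerN hornerC.
  rewrite (_ : _ - _ = - w.[a] * (d * b - 1)); last by ring.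
  exact: dividesMl.
have ud := loc_unit_coef nd; have nz := loc_unit_neq0 ud.
rewrite (_ : _ / _ = x / i d).
  by apply: locM => //; apply/loc_unit_loc/loc_unitV.
apply: (mulIf nz); apply: (mulIf ipi0); rewrite divfK //.
rewrite mulrAC divfK // [x * _]mulrC -Ex evB evC -E !rmorphM; ring.
Qed.

Lemma loc_divides b c : divides pi (b - c) -> loc ((i b - i c) / i pi).
Proof.
move=> [t Et]; rewrite -rmorphB Et rmorphM mulfK //.
by rewrite -evC; exact: loc_ev.
Qed.

Lemma loc_ord_gt0 y n : loc (y / i pi) -> ord y n -> 0 < n.
Proof.
by move=> ly oy; have := @loc_ord _ _ _ 1 ly _ oy; apply; rewrite expr1z mulrC divfK.
Qed.

End LocalRing.

(** * Valuations of residue degree one *)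

Definition valuation (K : fieldType) (v : K -> int) : Prop :=
  (forall x y, x != 0 -> y != 0 -> v (x * y) = v x + v y) /\
  (forall x y, x != 0 -> y != 0 -> x + y != 0 -> Num.min (v x) (v y) <= v (x + y)).

Section Valuation.
Variables (K : fieldType) (v : K -> int).
Hypothesis v_val : valuation v.

Lemma valuationM x y : x != 0 -> y != 0 -> v (x * y) = v x + v y.
Proof. exact: v_val.1. Qed.

Lemma valuation1 : v 1 = 0.
Proof.
have := valuationM (oner_neq0 _) (oner_neq0 _); rewrite mulr1 => /eqP.
by rewrite -subr_eq0 opprD addrA subrr sub0r oppr_eq0 => /eqP.
Qed.

Lemma valuationV x : x != 0 -> v x^-1 = - v x.
Proof.
move=> x0; apply/eqP.
by rewrite -addr_eq0 -valuationM ?invr_eq0 // mulVf // valuation1.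
Qed.

Lemma valuationXn x n : x != 0 -> v (x ^+ n) = v x *+ n.
Proof.
move=> x0; elim: n => [|n IHn]; first by rewrite expr0 valuation1.
by rewrite exprS valuationM ?expf_neq0 // IHn mulrS.
Qed.

Lemma valuationXz x (n : int) : x != 0 -> v (x ^ n) = v x * n.
Proof.
move=> x0; case: n => n; first by rewrite -exprnP valuationXn // -mulr_natr natz.
rewrite NegzE -exprz_inv -exprnP valuationXn ?invr_eq0 // valuationV //.
by rewrite mulNrn -mulr_natr natz mulrN.
Qed.
End Valuation.

Definition fraction_map (D : idomainType) (k0 : fieldType) (iota : D -> k0) : Prop :=
  injective iota /\ forall x, exists a b, b != 0 /\ x = iota a / iota b.

Lemma clear_denominators (D : idomainType) (k0 : fieldType)
    (iota : {rmorphism D -> k0}) (p : {poly k0}) : fraction_map iota ->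
  exists d g, d != 0 /\ iota d *: p = map_poly iota g.
Proof.
move=> [iota_inj frac]; elim/poly_ind: p => [|p c [d [g [d0 E]]]].
  by exists 1, 0; rewrite oner_neq0 rmorph0 scaler0.
have [a [b [b0 cE]]] := frac c.
have ib0 : iota b != 0 by rewrite -(rmorph0 iota) (inj_eq iota_inj).
exists (d * b), (b *: g * 'X + (d * a)%:P); split; first by rewrite mulf_neq0.
rewrite rmorphD /= [map_poly iota (_ * 'X)]rmorphM /= map_polyX map_polyC map_polyZ.
rewrite -E scalerDr !(rmorphM iota); congr (_ + _).
  by rewrite -!scalerAl scalerA mulrC.
by rewrite -mul_polyC cE -polyCM; congr polyC; field.
Qed.

Section PurelyInseparableExponent.
Variables (k0 : fieldType) (M : fieldExtType k0) (E : {subfield M}).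

Lemma purely_inseparable_exponent : purely_inseparable E {:M} ->
  exists2 Q, [pchar M].-nat Q & forall y, y ^+ Q \in E.
Proof.
move=> /purely_inseparableP insep.
have [Q Qp QE] : exists2 Q, [pchar M].-nat Q &
    forall y, y \in (vbasis {:M} : seq M) -> y ^+ Q \in E.
  elim: (vbasis {:M} : seq M) => [|b s [Q Qp QE]]; first by exists 1%N.
  have /purely_inseparable_elementP_pchar[n np bn] := insep b (memvf b).
  exists (Q * n)%N; first by rewrite pnatM Qp.
  move=> y; rewrite inE => /predU1P[->|/QE yQ].
    by rewrite mulnC exprM rpredX.
  by rewrite exprM rpredX.
exists Q => // y; rewrite (coord_vbasis (memvf y)).
elim/big_ind : _ => [|u w uE wE|j _].
- have /andP[Q0 _] := Qp.
  by rewrite expr0n eqn0Ngt Q0 rpred0.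
- by rewrite exprDn_pchar // rpredD.
- by rewrite exprZn rpredZ // QE // mem_nth // size_tuple.
Qed.
End PurelyInseparableExponent.

Section ResidueDegreeOne.
Variables (D : idomainType) (N : D -> nat) (k0 : fieldType).
Variables (iota : {rmorphism D -> k0}) (M : fieldExtType k0).
Hypothesis normN : euclidean_norm N.
Hypothesis frac : fraction_map iota.
Let i : {rmorphism D -> M} := (in_alg M \o iota : {rmorphism D -> M}).

Let i_inj : injective i.
Proof. by move=> x y /fmorph_inj /frac.1. Qed.

Let mapi g : map_poly i g = map_poly (in_alg M) (map_poly iota g).
Proof. by rewrite -map_poly_comp. Qed.

Let i_neq0 d : d != 0 -> i d != 0.
Proof. by rewrite -(inj_eq i_inj) rmorph0. Qed.

Lemma Fadjoin1_quotient z y : y \in <<1; z>>%VS ->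
  exists w d, d != 0 /\ y * i d = (map_poly i w).[z].
Proof.
move/Fadjoin1_polyP => [q ->]; have [d [w [d0 E]]] := clear_denominators q frac.
by exists w, d; split => //; rewrite mapi -E map_polyZ hornerZ mulrC.
Qed.

(** The valuation is v(y) = ord(y ^ Q), where ord is the order at a prime pi in
    the local ring of k0(z) at a simple root modulo pi.  It is 0 at m as soon
    as pi does not divide m, and finitely many pi can be avoided. *)
Lemma residue_degree_one_valuation (ys : seq M) m : m != 0 ->
  exists v : M -> int,
  [/\ valuation v, forall d, d != 0 -> 0 <= v (i d), v (i m) = 0,
      exists2 pi, pi != 0 & 0 < v (i pi) &
      forall y, y \in ys -> exists b, y = i b \/ 0 < v (y - i b)].
Proof.
move=> m0.
have [z [_ sepz] /purely_inseparable_exponent[Q Qp Qz]] :=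
  separable_inseparable_decomposition {:M} 1%AS.
have [p0 Ep0] : exists q, minPoly 1 z = map_poly (in_alg M) q.
  exact/polyOver1P/minPolyOver.
have [c [f [c0 Ef]]] := clear_denominators p0 frac.
have Eif : map_poly i f = i c *: minPoly 1 z.
  by rewrite mapi -Ef map_polyZ Ep0.
have sf : size f = size (minPoly 1 z).
  by rewrite -(size_map_inj_poly i_inj (rmorph0 i)) Eif size_scale // i_neq0.
have f1 : (1 < size f)%N by rewrite sf size_minPoly.
have fz : (map_poly i f).[z] = 0 by rewrite Eif hornerZ minPolyxx mulr0.
have over1 (r : {poly D}) : map_poly i r \is a polyOver 1%VS.
  by rewrite mapi alg_polyOver.
have fmin (r : {poly D}) : (size r < size f)%N -> (map_poly i r).[z] = 0 -> r = 0.
  move=> sr rz; apply: (map_inj_poly i_inj (rmorph0 i)); rewrite rmorph0.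
  apply/eqP; rewrite -(root_small_adjoin_poly (x := z) (over1 r)) ?rootE ?rz //.
  by rewrite size_map_inj_poly ?rmorph0 // -ltnS -size_minPoly -sf.
have ev_inv (w : {poly D}) : (map_poly i w).[z] != 0 ->
    exists w' d, d != 0 /\ (map_poly i w).[z] * (map_poly i w').[z] = i d.
  move=> w0; have [|w' [d [d0 E]]] := @Fadjoin1_quotient z (map_poly i w).[z]^-1.
    by rewrite rpredV mempx_Fadjoin.
  by exists w', d; split => //; rewrite -E mulrA divff // mul1r.
have f'z : (map_poly i f^`()).[z] != 0.
  rewrite -deriv_map Eif derivZ hornerZ mulf_neq0 ?i_neq0 //.
  by have := separable_root_der 1%AS z; rewrite sepz.
have [w' [dl [dl0 Edl]]] := ev_inv _ f'z.
have quot y : exists w d, d != 0 /\ y ^+ Q * i d = (map_poly i w).[z].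
  exact/Fadjoin1_quotient/Qz.
have /choice[den denP] : forall y, exists d, d != 0 /\
   exists w, y ^+ Q * i d = (map_poly i w).[z].
  by move=> y; have [w [d [d0 E]]] := quot y; exists d; split; last by exists w.
(* The primes dividing m' are those to avoid: the second factor makes the
   reduction of f keep its degree, the third one makes the root simple, and the
   last one keeps the y ^ Q in the local ring. *)
pose m' := m * lead_coef f * dl * \prod_(y <- ys) den y.
have m'0 : m' != 0.
  rewrite !mulf_neq0 // ?lead_coef_eq0 -?size_poly_gt0 1?ltnW //.
  by rewrite prodf_seq_neq0; apply/allP => y _ /=; case: (denP y).
have [pi [a [mpi pi0 npi pif]]] := maximal_dividing_value normN f1 m'0.
have npi_lead : ~ divides pi (lead_coef f).
  by move=> h; apply: npi; rewrite /m'; do 2 apply: dividesMr; apply: dividesMl.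
have npi_m : ~ divides pi m.
  by move=> h; apply: npi; rewrite /m'; do 3 apply: dividesMr.
have npi_dl : ~ divides pi dl.
  by move=> h; apply: npi; rewrite /m'; apply: dividesMr; apply: dividesMl.
have npi_den y : y \in ys -> ~ divides pi (den y).
  move=> yy h; apply: npi; rewrite /m'; apply: dividesMl.
  by rewrite (big_rem y) //=; apply: dividesMr.
have red : simple_reduction i z f pi a.
  by split => //; exists w', dl.
have addQ (x y : M) : (x + y) ^+ Q = x ^+ Q + y ^+ Q by rewrite exprDn_pchar.
have addQD (x y : D) : (x + y) ^+ Q = x ^+ Q + y ^+ Q.
  by apply: i_inj; rewrite rmorphXn rmorphD addQ rmorphD !rmorphXn.
have subQ (x y : M) : (x - y) ^+ Q = x ^+ Q - y ^+ Q.
  by rewrite -{2}(subrK y x) [in RHS]addQ addrK.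
have Q0 : (0 < Q)%N by case/andP: Qp.
pose ordz := ord i z pi a.
pose v y := xget 0 [set n | ordz (y ^+ Q) n]%classic.
have vP y : y != 0 -> ordz (y ^+ Q) (v y).
  move=> y0; rewrite /v; case: xgetP => [n _ //|none].
  have [w [d [d0 E]]] := quot y.
  have yQ0 : y ^+ Q != 0 by rewrite expf_neq0.
  have [n on] := ord_quotient red normN yQ0 d0 E.
  by case: (none n).
have vE y n : y != 0 -> ordz (y ^+ Q) n -> v y = n.
  move=> /vP h h'.
  exact: (ord_uniq red h h').
exists v; split.
- split=> x y x0 y0; first apply: vE; rewrite ?mulf_neq0 // ?exprMn.
    by apply: (ordM red); apply: vP.
  move=> xy0; apply: (ordD red (vP _ x0) (vP _ y0)).
  by rewrite -addQ; apply: vP.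
- move=> d d0; have dQ0 : d ^+ Q != 0 by rewrite expf_neq0.
  have [n] := ord_coef red normN dQ0.
  by rewrite rmorphXn => on n0; rewrite (vE _ n) // i_neq0.
- apply: vE; rewrite ?i_neq0 // -rmorphXn.
  exists (i (m ^+ Q)); last by rewrite expr0z mul1r.
  by apply: (loc_unit_coef red) => /(maximal_prime_exp mpi).
- exists pi => //; rewrite (vE _ Q%:Z) ?i_neq0 //.
  exists 1; last by rewrite mulr1 exprnP.
  by rewrite -(rmorph1 i); apply: (loc_unit_coef red); case: mpi.
- move=> y yys; have [_ [w Ew]] := denP y.
  (* The residue of y ^ Q is that of some e in D, which is a Q-th power b ^ Q
   modulo pi, and (y - b) ^ Q = y ^ Q - b ^ Q. *)
have [e le] := ord_residue red (npi_den _ yys) Ew.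
  have [b Hb] := residue_field_perfect normN e mpi pi0 addQD.
  exists b; have [->|yb] := eqVneq y (i b); [by left|right].
  have yb0 : y - i b != 0 by rewrite subr_eq0.
  apply: (loc_ord_gt0 red _ (vP _ yb0)).
  have -> : (y - i b) ^+ Q / i pi = (y ^+ Q - i e) / i pi - (i (b ^+ Q) - i e) / i pi.
    by rewrite subQ rmorphXn -mulrBl; congr (_ / _); ring.
  rewrite -mulNr opprB; apply: (locD red le); apply: (loc_divides red).
  by rewrite -opprB; apply: dividesN.
Qed.

End ResidueDegreeOne.

(** * Construction of finite extensions *)

Lemma irreducible_factor (F : fieldType) (p : {poly F}) : (1 < size p)%N ->
  exists2 q, irreducible_poly q & q %| p.
Proof.
have [n] := ubnP (size p); elim: n p => // n IHn p sp p1.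
have [irr|] := pselect (irreducible_poly p); first by exists p.
move=> nirr; have [q [q1 qp nqp]] :
    exists q : {poly F}, [/\ size q != 1, q %| p & ~~ (q %= p)].
  apply: contrapT => H; apply: nirr; split => // q q1 qp.
  by apply: contrapT => /negP nqp; apply: H; exists q.
have p0 : p != 0 by rewrite -size_poly_gt0 ltnW.
have q0 : q != 0 by apply: contraNneq p0 => q0; move: qp; rewrite q0 dvd0p.
have sq : (size q < size p)%N by rewrite ltn_neqAle dvdp_leq // dvdp_size_eqp // nqp.
have [||r irr rq] := IHn q.
- exact: leq_trans sq _.
- by rewrite ltn_neqAle eq_sym q1 size_poly_gt0.
by exists r => //; apply: dvdp_trans qp.
Qed.

Lemma adjoin_kth_roots (k0 : fieldType) (L : fieldExtType k0) (k : nat) (s : seq L) :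
  (0 < k)%N ->
  exists (M : fieldExtType k0) (j : {rmorphism L -> M}),
    (forall c : k0, j c%:A = c%:A) /\ forall a, a \in s -> exists b, b ^+ k = j a.
Proof.
move=> k0'; elim: s => [|a s [M [j [jA js]]]].
  by exists L, idfun.
have [|q irr qdv] := @irreducible_factor _ ('X^k - (j a)%:P : {poly M}).
  by rewrite size_XnsubC.
have [M' _ [z qz _]] := irredp_FAdjoin irr.
pose j' : {rmorphism L -> baseFieldType M'} := (in_alg M' \o j : {rmorphism L -> M'}).
exists (baseFieldType M'), j'; split.
  by move=> c; rewrite /= jA; rewrite baseField_scaleE.
move=> b; rewrite inE => /predU1P[->|/js[c Ec]]; last first.
  by exists (in_alg M' c : M'); have := rmorphXn (in_alg M') k c; rewrite Ec => /esym.
exists (z : M'); apply/eqP; rewrite -subr_eq0.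
have /dvdpP[r Er] := qdv.
have : root (map_poly (in_alg M') ('X^k - (j a)%:P)) z.
  by rewrite Er rmorphM rootM qz orbT.
by rewrite rmorphB /= map_polyXn map_polyC /root hornerD hornerN hornerXn hornerC.
Qed.

Lemma fraction_map_extend (D : idomainType) (k0 K : fieldType)
    (iota : {rmorphism D -> k0}) (phi : {rmorphism D -> K}) :
  fraction_map iota -> injective phi ->
  exists xi : {rmorphism k0 -> K}, forall d, xi (iota d) = phi d.
Proof.
move=> [iota_inj frac] phi_inj.
have /choice[num /choice[den E]] := frac.
have nz d : d != 0 -> phi d != 0 by rewrite -(inj_eq phi_inj) rmorph0.
have inz d : d != 0 -> iota d != 0 by rewrite -(inj_eq iota_inj) rmorph0.
pose xi x := phi (num x) / phi (den x).
have xiE x a b : b != 0 -> x = iota a / iota b -> xi x = phi a / phi b.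
  move=> b0 xE; have [d0 xE'] := E x.
  apply/eqP; rewrite eqr_div ?nz // -!rmorphM (inj_eq phi_inj).
  by rewrite -(inj_eq iota_inj) !rmorphM -eqr_div ?inz // -xE' xE.
have xi_d d : xi (iota d) = phi d.
  by rewrite (xiE _ d 1) ?oner_neq0 ?rmorph1 ?divr1.
have add : zmod_morphism xi.
  move=> x y; have [dx Ex] := E x; have [dy Ey] := E y.
  rewrite (xiE _ (num x * den y - num y * den x) (den x * den y)) ?mulf_neq0 //.
    by rewrite /xi rmorphB !rmorphM; field; rewrite !nz.
  by rewrite {1}Ex {1}Ey rmorphB !rmorphM; field; rewrite !inz.
have mul : monoid_morphism xi.
  split; first by rewrite -(rmorph1 iota) xi_d rmorph1.
  move=> x y; have [dx Ex] := E x; have [dy Ey] := E y.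
  rewrite (xiE _ (num x * num y) (den x * den y)) ?mulf_neq0 //.
    by rewrite /xi !rmorphM; field; rewrite !nz.
  by rewrite {1}Ex {1}Ey !rmorphM; field; rewrite !inz.
pose za := GRing.isZmodMorphism.Build _ _ xi add.
pose mm := GRing.isMonoidMorphism.Build _ _ xi mul.
pose xir : {rmorphism k0 -> K} := HB.pack xi za mm.
by exists xir.
Qed.

(** The finite extension L of k0 is built as an abstract extension mapping to K,
    since K itself comes without a vector space structure over k0. *)
Lemma finite_model (k0 K : fieldType) (xi : {rmorphism k0 -> K}) (s : seq K) :
  (forall x, x \in s -> algebraicOver xi x) ->
  exists (L : fieldExtType k0) (h : {rmorphism L -> K}),
    (forall c : k0, h c%:A = xi c) /\ forall x, x \in s -> exists y, h y = x.
Proof.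
elim: s => [|x s IHs] alg.
  exists k0^o, (xi : {rmorphism k0^o -> K}); split => // c.
  by rewrite /GRing.scale /= mulr1.
have [|L [h [hA hs]]] := IHs; first by move=> y ys; apply: alg; rewrite inE ys orbT.
have [p p0 px] := alg x (mem_head _ _).
(* The polynomial over L of least degree with root x is irreducible. *)
have exn : exists n,
    `[< exists p : {poly L}, [/\ p != 0, root (map_poly h p) x & size p = n] >].
  exists (size (map_poly (in_alg L) p)); apply/asboolP.
  exists (map_poly (in_alg L) p); split => //; first by rewrite map_poly_eq0.
  by rewrite -map_poly_comp (eq_map_poly hA).
case: (ex_minnP exn) => n /asboolP[q [q0 qx qn]] nmin.
have irr : irreducible_poly q.
  apply/(subfx_irreducibleP qx q0) => r rx r0; rewrite qn; apply: nmin.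
  by apply/asboolP; exists r.
pose M : fieldExtType L := SubFieldExtType qx irr.
pose h' : {rmorphism baseFieldType M -> K} := (subfx_inj : {rmorphism subFExtend h x q -> K}).
exists (baseFieldType M), h'; split.
  by move=> c; rewrite baseField_scaleE; rewrite -hA; exact: (subfx_inj_base qx q0).
move=> y; rewrite inE => /predU1P[->|/hs[b Eb]].
  by exists (subfx_root h x q : subFExtend h x q); exact: subfx_inj_root.
by exists (b%:A : M); rewrite -Eb; exact: (subfx_inj_base qx q0).
Qed.

(** * Function fields of one variable *)

Lemma tofrac_fraction_map (D : idomainType) :
  fraction_map (@FracField.tofrac D).
Proof.
split; first by move=> x y /eqP; rewrite tofrac_eq => /eqP.
elim/quotW => r; exists r.1, r.2; split; first exact: denom_ratioP.
have r2 : (FracField.tofrac r.2 : {fraction D}) != 0 by rewrite tofrac_eq0 denom_ratioP.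
apply: (mulIf r2); rewrite divfK // {r2}.
unlock FracField.tofrac; rewrite -[LHS]FracField.pi_mul.
apply/eqmodP; rewrite /= FracField.equivfE /FracField.mulf.
by rewrite !numden_Ratio ?mulf_neq0 ?oner_neq0 ?denom_ratioP // !mulr1 mulrC.
Qed.

Section Model.
Variables (F : fieldType) (K : fieldType) (phi : {rmorphism F -> K}).

(** K is isomorphic, as an extension of F(X) acting through X -> x, to some
    [fieldExtType].  In particular x is transcendental over F. *)
Definition finite_over (x : K) :=
  exists (xi : {rmorphism {fraction {poly F}} -> K})
         (L : fieldExtType {fraction {poly F}}) (h : {rmorphism L -> K}),
    [/\ bijective h, forall c, h c%:A = xi c &
        forall g : {poly F}, xi (FracField.tofrac g) = (map_poly phi g).[x]].

Definition transcendental (x : K) := ~ algebraicOver phi x.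

Lemma transcendental_horner x (g : {poly F}) : transcendental x ->
  (map_poly phi g).[x] = 0 -> g = 0.
Proof.
move=> tx gx; apply: contrapT => /eqP g0; apply: tx; exists g => //.
exact/rootP.
Qed.

Definition eval_at (x : K) : {rmorphism {poly F} -> K} :=
  horner_morph (fun a => mulrC x (phi a) : GRing.comm _ _).

Lemma eval_atE x g : eval_at x g = (map_poly phi g).[x]. Proof. by []. Qed.

Lemma eval_at_inj x : transcendental x -> injective (eval_at x).
Proof.
move=> tx g h /eqP; rewrite -subr_eq0 -rmorphB => /eqP /(transcendental_horner tx).
by move/eqP; rewrite subr_eq0 => /eqP.
Qed.

Lemma eval_at_swap x t (g : {poly {poly F}}) :
  (map_poly (eval_at x) (swapXY g)).[t] = (map_poly (eval_at t) g).[x].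
Proof.
pose G := map_poly (map_poly phi) g.
have E y (u : {poly {poly F}}) z :
    (map_poly (eval_at y) u).[z] = (map_poly (map_poly phi) u).[z%:P].[y].
  rewrite -[RHS]/(horner_eval y _) -horner_map /= /horner_eval hornerC.
  by rewrite -map_poly_comp_id0 ?horner0.
by rewrite !E -swapXY_map horner2_swapXY.
Qed.

(** An algebraic relation between x and t can be read in either direction; it
    does not degenerate because x is transcendental. *)
Lemma algebraic_exchange x t : transcendental x ->
  (exists2 p : {poly {poly F}}, p != 0 & (map_poly (eval_at t) p).[x] = 0) ->
  exists2 p : {poly {poly F}}, p != 0 & (map_poly (eval_at x) p).[t] = 0.
Proof.
by move=> tx [p p0 px]; exists (swapXY p); rewrite ?swapXY_eq0 // eval_at_swap.
Qed.

Lemma finite_over_algebraic t y : finite_over t ->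
  exists2 p : {poly {poly F}}, p != 0 & (map_poly (eval_at t) p).[y] = 0.
Proof.
move=> [xi [L [h [[h' h'K hK] hA xiE]]]].
have [q Eq] : exists q, minPoly 1 (h' y) = map_poly (in_alg L) q.
  exact/polyOver1P/minPolyOver.
have [c [f [c0 Ef]]] := clear_denominators q (tofrac_fraction_map _).
exists f.
  apply: contraNneq c0 => f0; move/eqP: Ef.
  rewrite f0 rmorph0 scaler_eq0 tofrac_eq0 => /orP[//|/eqP q0].
  have := monic_neq0 (monic_minPoly 1%AS (h' y)).
  by rewrite Eq q0 rmorph0 eqxx.
have -> : map_poly (eval_at t) f =
    map_poly h (map_poly (in_alg L) (map_poly (@FracField.tofrac _) f)).
  by rewrite -!map_poly_comp; apply: eq_map_poly => g /=; rewrite hA xiE.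
rewrite -Ef map_polyZ -Eq -[X in _.[X]]hK horner_map /= hornerZ minPolyxx mulr0.
exact: rmorph0.
Qed.

(** By [algebraic_exchange], t is algebraic over F(x), hence so is every element
    of K, which is algebraic over F(t).  So K is generated over F(x) by finitely
    many algebraic elements: t and a basis of K over F(t). *)
Lemma finite_over_transcendental t x :
  finite_over t -> transcendental x -> finite_over x.
Proof.
move=> tfin tx.
have xinj := eval_at_inj tx.
have [xi xiE] := fraction_map_extend (tofrac_fraction_map _) xinj.
have algx z : (exists2 p : {poly {poly F}}, p != 0 & (map_poly (eval_at x) p).[z] = 0) ->
    algebraicOver xi z.
  move=> [p p0 pz]; exists (map_poly (@FracField.tofrac _) p).
    rewrite -size_poly_eq0 size_map_inj_poly ?size_poly_eq0 //.
    exact: (tofrac_fraction_map _).1.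
  by rewrite -map_poly_comp (eq_map_poly xiE); apply/rootP.
have algt : algebraicOver xi t.
  by apply: algx; apply: algebraic_exchange => //; apply: finite_over_algebraic.
have algphi c : algebraicOver xi (phi c).
  have <- : xi (FracField.tofrac c%:P) = phi c.
    by rewrite xiE eval_atE map_polyC hornerC.
  exact: algebraic_id.
have alg_ev g : algebraicOver xi (eval_at t g).
  apply/integral_algebraic; rewrite eval_atE.
  apply: integral_horner; last exact/integral_algebraic.
  by apply/integral_poly => i; rewrite coef_map; apply/integral_algebraic; exact: algphi.
have [xt [L0 [f0 [[f0' f0'K f0K] f0A xtE]]]] := tfin.
have alg_all y : algebraicOver xi y.
  have [p p0 py] := finite_over_algebraic y tfin.
  have pE : map_poly (eval_at t) p = map_poly xt (map_poly (@FracField.tofrac _) p).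
    by rewrite -map_poly_comp; apply: eq_map_poly => g /=; rewrite xtE.
  apply/integral_algebraic; apply: (integral_root (p := map_poly (eval_at t) p)).
  - rewrite pE map_poly_eq0 -size_poly_eq0 size_map_inj_poly ?size_poly_eq0 ?rmorph0 //.
    exact: (tofrac_fraction_map _).1.
  - exact/rootP.
  - apply/integral_poly => i; rewrite coef_map; apply/integral_algebraic.
    exact: alg_ev.
have [|L [h [hA hs]]] := @finite_model _ K xi (t :: [seq f0 b | b <- vbasis {:L0}]).
  by move=> y _; exact: alg_all.
exists xi, L, h; split=> //.
have hsur y : exists z, h z = y.
  pose rng y := exists z, h z = y.
  have rD u v : rng u -> rng v -> rng (u + v).
    by move=> [a <-] [b <-]; exists (a + b); rewrite rmorphD.
  have rM u v : rng u -> rng v -> rng (u * v).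
    by move=> [a <-] [b <-]; exists (a * b); rewrite rmorphM.
  have rV u : rng u -> rng u^-1.
    by move=> [a <-]; exists a^-1; rewrite fmorphV.
  have rt : rng t by apply: hs; rewrite mem_head.
  have rev g : rng (eval_at t g).
    rewrite eval_atE; elim/poly_ind: g => [|g c IHg].
      by rewrite rmorph0 horner0; exists 0; rewrite rmorph0.
    rewrite rmorphD rmorphM /= map_polyX map_polyC hornerMXaddC.
    apply: rD; first exact: rM.
    exists ((FracField.tofrac c%:P)%:A); rewrite hA xiE eval_atE.
    by rewrite map_polyC hornerC.
  have rxt c : rng (xt c).
    have [_ /(_ c)[a [b [b0 ->]]]] := tofrac_fraction_map {poly F}.
    by rewrite fmorph_div !xtE; apply: rM; last apply: rV; exact: rev.
  rewrite -/(rng y) -(f0K y) (coord_vbasis (memvf (f0' y))) rmorph_sum /=.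
  elim/big_ind: _ => [||j _]; [by exists 0; rewrite rmorph0|exact: rD|].
  rewrite -mulr_algl rmorphM; apply: rM; first by rewrite f0A.
  apply: hs; rewrite inE; apply/orP; right; apply: map_f.
  by apply: mem_nth; rewrite size_tuple.
have /choice[h' h'K] := hsur.
by exists h' => // z; apply: (fmorph_inj h); rewrite h'K.
Qed.

End Model.

Section Rank.
Variables (F : fieldType) (K : fieldType) (phi : {rmorphism F -> K}) (y : K).
Hypothesis yfin : finite_over phi y.
Let ev := eval_at phi y.

Lemma finite_over_is_transcendental : transcendental phi y.
Proof.
move=> [p p0 /rootP py]; case: yfin => xi [_ [_ [_ _ xiE]]].
move: py; rewrite -xiE => /eqP; rewrite fmorph_eq0 tofrac_eq0.
by rewrite (negPf p0).
Qed.

Let ev_inj : injective ev := eval_at_inj finite_over_is_transcendental.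
Let ev_eq0 g : (ev g == 0) = (g == 0).
Proof. by rewrite -(inj_eq ev_inj) rmorph0. Qed.

(** If p(x) = 0 with p of degree m and leading coefficient c, then
    c ^ (m - 1) p(X / c) is monic with root c x. *)
Lemma integral_multiple x : exists2 c, c != 0 & integralOver ev (ev c * x).
Proof.
have [p p0 px] := finite_over_algebraic x yfin.
pose m := (size p).-1; pose c := lead_coef p.
have c0 : c != 0 by rewrite lead_coef_eq0.
have sp : size p = m.+1 by rewrite prednK // size_poly_gt0.
have m0 : (0 < m)%N.
  rewrite lt0n; apply: contraNneq p0 => m0.
  have pE : p = (p`_0)%:P by apply: size1_polyC; rewrite sp m0.
  have /eqP : ev p`_0 = 0 by rewrite -px {2}pE map_polyC hornerC.
  by rewrite ev_eq0 => /eqP p00; rewrite pE p00 polyC0.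
exists c => //.
pose q := \poly_(i < m.+1) (if i == m then 1 else p`_i * c ^+ (m.-1 - i)).
have sq : size q = m.+1 by rewrite size_poly_eq // eqxx oner_neq0.
exists q.
  by rewrite monicE lead_coefE sq coef_poly ltnSn eqxx.
apply/rootP; rewrite horner_coef size_map_inj_poly ?rmorph0 // sq.
transitivity (ev c ^+ m.-1 * (map_poly ev p).[x]); last by rewrite px mulr0.
rewrite horner_coef size_map_inj_poly ?rmorph0 // sp mulr_sumr.
apply: eq_bigr => i _; rewrite !coef_map /= coef_poly ltn_ord exprMn.
case: eqP => [im|/eqP im].
  rewrite im rmorph1 mul1r (_ : p`_m = c); last by rewrite /c lead_coefE.
  by rewrite mulrA -exprSr prednK.
have ilt : (i <= m.-1)%N by have := ltn_ord i; lia.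
rewrite rmorphM rmorphXn -(subnK ilt) exprD.
rewrite (_ : (m.-1 - i + i - i = m.-1 - i)%N) //; last by rewrite addnK.
by ring.
Qed.

(** This records what is needed of the degree n of K over F(y): n + 1 elements
    satisfy a linear relation with polynomial coefficients, and there are n
    independent elements that are moreover integral over F[y]. *)
Lemma finite_over_rank : exists n,
  (forall e : 'I_n.+1 -> K, exists g : 'I_n.+1 -> {poly F},
     (exists j, g j != 0) /\ \sum_j ev (g j) * e j = 0) /\
  exists om : 'I_n -> K, (forall i, integralOver ev (om i)) /\
     forall g : 'I_n -> {poly F}, \sum_i ev (g i) * om i = 0 -> forall i, g i = 0.
Proof.
case: yfin => xi [L [h [[h' h'K hK] hA xiE]]].
have hsc c b : h (c *: b) = xi c * h b by rewrite -mulr_algl rmorphM hA.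
exists (\dim {:L}); split.
  move=> e; pose X := [tuple h' (e j) | j < (\dim {:L}).+1].
  have /negP nf : ~~ free X.
    apply/negP; rewrite /free size_tuple => /eqP dX.
    by have := dimvS (subvf <<X>>%VS); rewrite dX ltnn.
  have [k [[j0 kj0] ksum]] : exists k : 'I_(\dim {:L}).+1 -> _,
      (exists j, k j != 0) /\ \sum_j k j *: X`_j = 0.
    apply: contrapT => H; apply: nf; apply/freeP => k ksum j.
    by apply: contrapT => /eqP kj; apply: H; exists k; split => //; exists j.
  have /choice[num /choice[den E]] := (tofrac_fraction_map {poly F}).2.
  exists (fun j => num (k j) * \prod_(l | l != j) den (k l)); split.
    exists j0; apply: mulf_neq0.
      apply: contraNneq kj0 => n0; have [_ ->] := E (k j0).
      by rewrite n0 rmorph0 mul0r.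
    by apply/prodf_neq0 => l _; case: (E (k l)).
  transitivity (ev (\prod_l den (k l)) * h (\sum_j k j *: X`_j)); last first.
    by rewrite ksum rmorph0 mulr0.
  rewrite rmorph_sum mulr_sumr; apply: eq_bigr => j _.
  rewrite hsc -tnth_nth tnth_mktuple hK mulrA; congr (_ * _).
  have [d0 kE] := E (k j).
  have -> : xi (k j) = ev (num (k j)) / ev (den (k j)).
    by rewrite {1}kE fmorph_div !xiE.
  by rewrite [in RHS](bigD1 j) //= !rmorphM /=; field; rewrite ev_eq0.
have /choice[c cP] : forall x, exists c, c != 0 /\ integralOver ev (ev c * x).
  by move=> x; have [c] := integral_multiple x; exists c.
pose om (i : 'I_(\dim {:L})) := h (vbasis {:L})`_i.
exists (fun i => ev (c (om i)) * om i); split; first by move=> i; case: (cP (om i)).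
move=> g gsum i.
have fr := basis_free (vbasisP {:L}).
have /freeP/(_ (fun i => FracField.tofrac (g i * c (om i)))) := fr.
have -> : \sum_j FracField.tofrac (g j * c (om j)) *: (vbasis {:L})`_j = 0.
  apply: (fmorph_inj h); rewrite rmorph0 -[RHS]gsum rmorph_sum.
  apply: eq_bigr => j _; rewrite hsc xiE -eval_atE -/ev rmorphM /om.
  by rewrite mulrA.
move=> /(_ erefl i)/eqP; rewrite tofrac_eq0 mulf_eq0 => /orP[/eqP//|].
by case: (cP (om i)) => /negPf ->.
Qed.

(** If y b were algebraic over F, then so would be its inverse, and 1 / y, which
    is b times this inverse, would be integral over F[y].  Multiplying an
    integral equation of 1 / y by a power of y gives a polynomial with constant
    coefficient 1 that vanishes at y. *)
Lemma transcendental_mul_integral b : integralOver ev b -> b != 0 ->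
  transcendental phi (y * b).
Proof.
move=> bint b0 /algebraic_inv yb.
have y0 : y != 0.
  have : ev 'X != 0 by rewrite ev_eq0 polyX_eq0.
  by rewrite /ev eval_atE map_polyX hornerX.
have int_inv : integralOver ev y^-1.
  have -> : y^-1 = (y * b)^-1 * b by field; rewrite b0 y0.
  apply: integral_mul => //.
  have /integral_algebraic := yb; case=> p pm pr.
  exists (map_poly polyC p); first exact: monic_map.
  rewrite -map_poly_comp; have -> // : map_poly (ev \o polyC) p = map_poly phi p.
  by apply: eq_map_poly => a /=; rewrite /ev eval_atE map_polyC hornerC.
case: int_inv => p pm /rootP pr.
pose m := (size p).-1.
have sp : size p = m.+1 by rewrite prednK // size_poly_gt0 monic_neq0.
pose g := 1 + 'X * \sum_(i < m) p`_i * 'X^(m.-1 - i).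
have : ev g = 0.
  transitivity (y ^+ m * (map_poly ev p).[y^-1]); last by rewrite pr mulr0.
  rewrite horner_coef size_map_inj_poly ?rmorph0 // sp mulr_sumr big_ord_recr /=.
  have evX : ev 'X = y by rewrite /ev eval_atE map_polyX hornerX.
  rewrite coef_map /= -[p`_m]/(p`_(size p).-1) -lead_coefE (monicP pm) rmorph1 mul1r.
  rewrite -exprMn divff // expr1n addrC rmorphD rmorph1 rmorphM evX rmorph_sum mulr_sumr.
  congr (_ + _); apply: eq_bigr => i _.
  rewrite coef_map rmorphM rmorphXn evX.
  have -> : y ^+ m = y * y ^+ (m.-1 - i) * y ^+ i.
    by rewrite -exprS -exprD; congr (_ ^+ _); have := ltn_ord i; lia.
  by rewrite exprVn; field; rewrite expf_neq0.
move=> /eqP; rewrite ev_eq0 => /eqP /(congr1 (fun q : {poly F} => q.[0])).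
by rewrite hornerD hornerM hornerX mul0r addr0 !hornerC => /eqP; rewrite oner_eq0.
Qed.

End Rank.

(** * Absolute values *)

Section RealPowers.
Variable R : realType.
Implicit Types (t a C : R).

Lemma bernoulli t n : 0 <= t -> 1 + n%:R * t <= (1 + t) ^+ n.
Proof.
move=> t0; elim: n => [|n IHn]; first by rewrite mul0r addr0.
rewrite exprS; apply: le_trans (ler_wpM2l (_ : 0 <= 1 + t) IHn); last by lra.
have := mulr_ge0 (ler0n R n) (mulr_ge0 t0 t0).
by rewrite -natr1; nra.
Qed.

Lemma exp_unbounded t C : 1 < t -> 0 <= C -> exists N, forall n, (N <= n)%N -> C < t ^+ n.
Proof.
move=> t1 C0; have t0 : 0 < t - 1 by lra.
exists (Num.bound (C / (t - 1))) => n Nn.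
have := bernoulli n (ltW t0); rewrite (_ : 1 + (t - 1) = t); last by ring.
apply: lt_le_trans.
have : C / (t - 1) < n%:R.
  apply: lt_le_trans (_ : (Num.bound (C / (t - 1)))%:R <= _); last by rewrite ler_nat.
  by rewrite archi_boundP // divr_ge0 // ltW.
by rewrite ltr_pdivrMr //; lra.
Qed.

Lemma exp_small a C : 0 <= a < 1 -> 0 < C ->
  exists N, forall n, (N <= n)%N -> a ^+ n < C.
Proof.
move=> /andP[a0 a1] C0; have [->|an0] := eqVneq a 0.
  by exists 1%N => -[//|n] _; rewrite expr0n.
have ap : 0 < a by rewrite lt_def an0.
have [||N NP] := @exp_unbounded a^-1 C^-1; rewrite ?invf_gt1 ?invr_ge0 ?ltW //.
exists N => n /NP; rewrite exprVn ltf_pV2 // ?posrE ?exprn_gt0 //.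
Qed.

Lemma exp_small_family r (a C : nat -> R) (J : pred nat) :
  (forall i, (i < r)%N -> J i -> 0 <= a i < 1) ->
  (forall i, 0 < C i) ->
  exists N, forall n, (N <= n)%N -> forall i, (i < r)%N -> J i -> a i ^+ n < C i.
Proof.
elim: r => [|r IHr] ha hC; first by exists 0%N.
have [|N NP] := IHr _ hC; first by move=> i ir; apply: ha; rewrite ltnW.
have [Jr|nJr] := boolP (J r); last first.
  exists N => n Nn i; rewrite ltnS leq_eqVlt => /predU1P[->|].
    by rewrite (negPf nJr).
  exact: NP.
have [|//|N' NP'] := @exp_small (a r) (C r); first exact: ha.
exists (maxn N N') => n; rewrite geq_max => /andP[Nn Nn'] i.
rewrite ltnS leq_eqVlt => /predU1P[->|] *; [exact: NP'|exact: NP].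
Qed.
End RealPowers.

Section AbsoluteValues.
Variables (R : realType) (K : fieldType).
Implicit Types (u w : K -> R) (v : K -> int).

Definition ultrametric u := absolute_value u /\ nonarchimedean u.

Section One.
Variables (u : K -> R).
Hypothesis uabs : absolute_value u.

Lemma av_ge0 x : 0 <= u x. Proof. by case: uabs => h *; apply: h. Qed.
Lemma av0 : u 0 = 0. Proof. by case: uabs => _ h *; apply/h. Qed.
Lemma av_eq0 x : (u x == 0) = (x == 0).
Proof. by case: uabs => _ h *; apply/eqP/eqP => /h. Qed.
Lemma av_gt0 x : (0 < u x) = (x != 0).
Proof. by rewrite lt_def av_eq0 av_ge0 andbT. Qed.
Lemma avM x y : u (x * y) = u x * u y.
Proof. by case: uabs => _ _ h *; apply: h. Qed.
Lemma av1 : u 1 = 1.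
Proof.
have u10 : u 1 != 0 by rewrite av_eq0 oner_neq0.
by apply: (mulfI u10); rewrite -avM !mulr1.
Qed.
Lemma avX x n : u (x ^+ n) = u x ^+ n.
Proof. by elim: n => [|n IHn]; rewrite ?expr0 ?av1 // !exprS avM IHn. Qed.
Lemma avV x : u x^-1 = (u x)^-1.
Proof.
have [->|x0] := eqVneq x 0; first by rewrite invr0 av0 invr0.
have ux0 : u x != 0 by rewrite av_eq0.
by apply: (mulfI ux0); rewrite -avM !divff // av1.
Qed.
Lemma av_div x y : u (x / y) = u x / u y. Proof. by rewrite avM avV. Qed.
Lemma av_root1 x n : (0 < n)%N -> x ^+ n = 1 -> u x = 1.
Proof.
move=> n0 xn; apply/eqP; rewrite -(pexpr_eq1 n0 (av_ge0 x)).
by rewrite -avX xn av1.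
Qed.
Lemma avN x : u (- x) = u x.
Proof.
by rewrite -mulN1r avM (@av_root1 (-1) 2) ?mul1r // expr2 mulrNN mulr1.
Qed.
Lemma av_finite (F : finFieldType) (phi : {rmorphism F -> K}) c :
  c != 0 -> u (phi c) = 1.
Proof.
move=> c0; have cn : c ^+ #|F|.-1 = 1.
  apply: (mulfI c0); rewrite mulr1 -exprS prednK ?expf_card //.
  by apply/card_gt0P; exists 0.
apply: (@av_root1 _ #|F|.-1); last by rewrite -rmorphXn cn rmorph1.
by have := finNzRing_gt1 F; case: #|F| => [|[]].
Qed.
Lemma av_finite_le1 (F : finFieldType) (phi : {rmorphism F -> K}) c : u (phi c) <= 1.
Proof.
have [->|c0] := eqVneq c 0; first by rewrite rmorph0 av0.
by rewrite av_finite.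
Qed.

(** The triangle inequality applied to p ^ N-th powers gives
    u (x + y) ^ (p ^ N) <= 2 M ^ (p ^ N), with M the maximum of u x and u y; as
    N is arbitrary, u (x + y) <= M. *)
Lemma nonarchimedean_pchar p : p \in [pchar K] -> nonarchimedean u.
Proof.
move=> pK x y; set M := Num.max (u x) (u y).
have M0 : 0 <= M by rewrite le_max av_ge0.
have uM : u x <= M /\ u y <= M by rewrite !le_max !lexx orbT.
have [MM|Mp] := eqVneq M 0.
  have x0 : x = 0 by apply/eqP; rewrite -av_eq0 eq_le av_ge0 andbT -MM; case: uM.
  have y0 : y = 0 by apply/eqP; rewrite -av_eq0 eq_le av_ge0 andbT -MM; case: uM.
  by rewrite x0 y0 addr0 av0.
have {}Mp : 0 < M by rewrite lt_def Mp.
rewrite leNgt; apply/negP => Mlt.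
have [|//|N NP] := @exp_unbounded R (u (x + y) / M) 2.
  by rewrite ltr_pdivlMr ?mul1r.
have p1 : (1 < p)%N by apply: prime_gt1; case/andP: pK.
have := NP (p ^ N)%N (ltnW (ltn_expl N p1)).
rewrite expr_div_n ltr_pdivlMr ?exprn_gt0 // -avX.
have -> : (x + y) ^+ (p ^ N) = x ^+ (p ^ N) + y ^+ (p ^ N).
  apply: exprDn_pchar; rewrite pnatX (eq_pnat _ (pcharf_eq pK)) pnat_id //.
  by case/andP: pK.
apply/negP; rewrite -leNgt.
have -> : 2 * M ^+ (p ^ N) = M ^+ (p ^ N) + M ^+ (p ^ N) by ring.
case: uabs => _ _ _ tri; apply: le_trans (tri _ _) _; rewrite !avX.
by apply: lerD; apply: lerXn2r; rewrite ?nnegrE ?av_ge0 //; case: uM.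
Qed.
End One.

Section Ultra.
Variables (u : K -> R).
Hypothesis uu : ultrametric u.
Let uabs := uu.1.

Lemma ultra_le x y C : u x <= C -> u y <= C -> u (x + y) <= C.
Proof. by move=> hx hy; apply: le_trans (uu.2 x y) _; rewrite ge_max hx. Qed.
Lemma ultra_lt x y C : u x < C -> u y < C -> u (x + y) < C.
Proof. by move=> hx hy; apply: le_lt_trans (uu.2 x y) _; rewrite gt_max hx. Qed.
Lemma ultra_sum_le I (r : seq I) (P : pred I) (E : I -> K) C : 0 <= C ->
  (forall i, P i -> u (E i) <= C) -> u (\sum_(i <- r | P i) E i) <= C.
Proof.
move=> C0 h; elim/big_ind: _ => //; first by rewrite (av0 uabs).
by move=> *; apply: ultra_le.
Qed.
Lemma ultra_sum_lt I (r : seq I) (P : pred I) (E : I -> K) C : 0 < C ->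
  (forall i, P i -> u (E i) < C) -> u (\sum_(i <- r | P i) E i) < C.
Proof.
move=> C0 h; elim/big_ind: _ => //; first by rewrite (av0 uabs).
by move=> *; apply: ultra_lt.
Qed.
Lemma ultra_dominant x y : u y < u x -> u (x + y) = u x.
Proof.
move=> yx; apply/eqP; rewrite eq_le ultra_le ?lexx ?(ltW yx) //= leNgt.
apply/negP => h; have : u (x + y - y) < u x by apply: ultra_lt; rewrite ?(avN uabs).
by rewrite addrK ltxx.
Qed.

(** If 1 < u x, then the leading term x ^ n of p(x) dominates all the others. *)
Lemma ultra_root_monic (p : {poly K}) x : p \is monic -> root p x ->
  (forall i, u p`_i <= 1) -> u x <= 1.
Proof.
move=> pm px pc; rewrite leNgt; apply/negP => x1.
have x0 : 0 < u x by apply: lt_trans x1.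
have := rootP px; rewrite horner_coef polySpred ?monic_neq0 // big_ord_recr /=.
rewrite -lead_coefE (monicP pm) mul1r addrC => E.
have : u (x ^+ (size p).-1) = u (x ^+ (size p).-1 + \sum_(i < (size p).-1) p`_i * x ^+ i).
  rewrite ultra_dominant //; apply: ultra_sum_lt; first by rewrite (avX uabs) exprn_gt0.
  move=> i _; rewrite (avM uabs) !(avX uabs).
  apply: le_lt_trans (_ : u x ^+ i < _); first by rewrite ler_piMl ?exprn_ge0 ?(ltW x0).
  by rewrite ltr_eXn2l.
by rewrite E (av0 uabs) (avX uabs) => /eqP; rewrite gt_eqF // exprn_gt0.
Qed.

Lemma ultra_integral (B : nzRingType) (f : {rmorphism B -> K}) x :
  (forall b, u (f b) <= 1) -> integralOver f x -> u x <= 1.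
Proof.
move=> fle [p pm px]; apply: (ultra_root_monic _ px); first exact: monic_map.
by move=> i; rewrite coef_map; exact: fle.
Qed.

Section Poly.
Variables (F : finFieldType) (phi : {rmorphism F -> K}) (y : K).

Lemma ultra_eval_le1 g : u y <= 1 -> u (eval_at phi y g) <= 1.
Proof.
move=> y1; rewrite eval_atE horner_coef; apply: ultra_sum_le => // i _.
rewrite coef_map (avM uabs) (avX uabs).
rewrite mulr_ile1 ?(av_ge0 uabs) ?exprn_ge0 ?(av_ge0 uabs) //.
  exact: av_finite_le1.
by rewrite exprn_ile1 ?(av_ge0 uabs).
Qed.

Hypothesis y1 : 1 < u y.

Lemma ultra_eval_le (g : {poly F}) d :
  (size g <= d.+1)%N -> u (eval_at phi y g) <= u y ^+ d.
Proof.
move=> gd; rewrite eval_atE horner_coef; apply: ultra_sum_le.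
  by rewrite exprn_ge0 ?(av_ge0 uabs).
move=> i _; rewrite coef_map (avM uabs) (avX uabs).
apply: le_trans (_ : u y ^+ i <= _).
  by rewrite ler_piMl ?exprn_ge0 ?(av_ge0 uabs) // (av_finite_le1 uabs).
rewrite ler_eXn2l // -ltnS; apply: leq_trans (ltn_ord i) _.
by apply: leq_trans gd; rewrite size_map_poly.
Qed.

Lemma ultra_eval (g : {poly F}) : g != 0 -> u (eval_at phi y g) = u y ^+ (size g).-1.
Proof.
move=> g0; have E : g = (lead_coef g)%:P * 'X^((size g).-1) + take_poly (size g).-1 g.
  have <- : drop_poly (size g).-1 g = (lead_coef g)%:P.
    apply/polyP => i; rewrite coef_drop_poly coefC lead_coefE.
    case: i => [|i] //=; rewrite nth_default //.
    by have : (0 < size g)%N; [rewrite size_poly_gt0|lia].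
  by rewrite addrC poly_take_drop.
rewrite {1}E rmorphD rmorphM rmorphXn /=.
have -> : eval_at phi y (lead_coef g)%:P = phi (lead_coef g).
  by rewrite eval_atE map_polyC hornerC.
have -> : eval_at phi y 'X = y by rewrite eval_atE map_polyX hornerX.
have ul : u (phi (lead_coef g) * y ^+ (size g).-1) = u y ^+ (size g).-1.
  by rewrite (avM uabs) (av_finite uabs) ?lead_coef_eq0 // mul1r avX.
rewrite ultra_dominant // ul.
case E1 : (size g).-1 => [|d].
  by rewrite take_poly0l // rmorph0 (av0 uabs).
apply: le_lt_trans (_ : u y ^+ d < _); last by rewrite ltr_eXn2l.
by apply: ultra_eval_le; rewrite size_take_poly.
Qed.
End Poly.
End Ultra.

Definition vabs (c : R) v (x : K) : R := if x == 0 then 0 else c ^ v x.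

Lemma vabs_ultrametric c v : 0 < c < 1 -> valuation v -> ultrametric (vabs c v).
Proof.
move=> /andP[c0 c1] [vM vD].
have cz n : 0 < c ^ n by rewrite exprz_gt0.
have cmono (n m : int) : n <= m -> c ^ m <= c ^ n.
  move=> nm; have -> : m = n + (`|m - n|)%N%:Z by rewrite gez0_abs; lia.
  rewrite expfzDr ?gt_eqF // ler_piMr ?(ltW (cz n)) // -exprnP.
  by rewrite exprn_ile1 ?(ltW c0) ?(ltW c1).
have na : nonarchimedean (vabs c v).
  move=> x y; rewrite /vabs.
  have [->|x0] := eqVneq x 0; first by rewrite add0r le_max lexx orbT.
  have [->|y0] := eqVneq y 0; first by rewrite addr0 (negPf x0) le_max lexx.
  have [xy0|xy0] := eqVneq (x + y) 0; first by rewrite le_max ltW.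
  have := vD x y x0 y0 xy0; rewrite ge_min le_max => /orP[/cmono->//|/cmono->].
  by rewrite orbT.
have ge0 x : 0 <= vabs c v x by rewrite /vabs; case: ifP => // _; apply/ltW.
split=> //; split=> //.
- move=> x; rewrite /vabs; split; last by move=> ->; rewrite eqxx.
  by case: eqP => // _ /eqP; rewrite gt_eqF.
- move=> x y; rewrite /vabs.
  have [->|x0] := eqVneq x 0; first by rewrite mul0r eqxx mul0r.
  have [->|y0] := eqVneq y 0; first by rewrite mulr0 eqxx mulr0.
  by rewrite mulf_eq0 (negPf x0) (negPf y0) vM // expfzDr // gt_eqF.
- move=> x y; apply: le_trans (na x y) _.
  by rewrite ge_max lerDl lerDr !ge0.
Qed.

Lemma vabs_le1 c v x : 0 < c < 1 -> x != 0 -> (vabs c v x <= 1) = (0 <= v x).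
Proof.
move=> /andP[c0 c1] x0; rewrite /vabs (negPf x0); case: (v x) => n.
  by rewrite -exprnP exprn_ile1 ?(ltW c0) ?(ltW c1).
by rewrite NegzE -exprz_inv -exprnP leNgt exprn_egt1 ?invf_gt1.
Qed.

Lemma vabs_lt1 c v x : 0 < c < 1 -> x != 0 -> (vabs c v x < 1) = (0 < v x).
Proof.
move=> /andP[c0 c1] x0; rewrite /vabs (negPf x0); case: (v x) => n.
  case: n => [|n]; first by rewrite expr0z ltxx.
  by rewrite -exprnP exprn_ilt1 ?(ltW c0).
by rewrite NegzE -exprz_inv -exprnP ltNge exprn_ege1 // ltW // invf_gt1.
Qed.

Lemma vabs_gt1 c v x : 0 < c < 1 -> x != 0 -> (1 < vabs c v x) = (v x < 0).
Proof. by move=> c01 x0; rewrite ltNge vabs_le1 // -ltNge. Qed.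

End AbsoluteValues.

(** * Places and weak approximation *)

Section Places.
Variables (R : realType) (K : fieldType).
Implicit Types (u w : K -> R) (v : K -> int) (P Q : set (K -> R)).

Lemma normalized_valuationW v : normalized_valuation v -> valuation v.
Proof. by case. Qed.

Lemma pord_cases P : pord P = (fun=> 0) \/
  normalized_valuation (pord P) /\ induces (pord P) P.
Proof. by rewrite /pord; case: xgetP => [v _ []|]; [right|left]. Qed.

Lemma equivalent_sym u w : absolute_value u -> equivalent u w -> equivalent w u.
Proof.
move=> ua [s s0 E]; exists s^-1; first by rewrite invr_gt0.
by move=> x; rewrite E -powRrM mulfV ?gt_eqF // powRr1 // av_ge0.
Qed.

Lemma equivalent_trans u1 u2 u3 : equivalent u1 u2 -> equivalent u2 u3 -> equivalent u1 u3.
Proof.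
move=> [s s0 E] [t t0 E']; exists (s * t); first by rewrite mulr_gt0.
by move=> x; rewrite E' E powRrM.
Qed.

Lemma equivalent_refl u : absolute_value u -> equivalent u u.
Proof. by move=> ua; exists 1 => // x; rewrite powRr1 // av_ge0. Qed.

Lemma place_absolute_value P u : place P -> P u -> absolute_value u.
Proof. by case=> w [_ _ ->] []. Qed.

Lemma place_class P u : place P -> P u ->
  P = [set w | absolute_value w /\ equivalent u w].
Proof.
move=> [u0 [ua0 _ ->]] [ua eu]; apply/seteqP; split=> w /= [wa ew]; split => //.
  exact: equivalent_trans (equivalent_sym ua0 eu) ew.
exact: equivalent_trans eu ew.
Qed.

Lemma place_eq P Q u w : place P -> place Q -> P u -> Q w -> equivalent u w -> P = Q.
Proof.
move=> pP pQ Pu Qw e.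
rewrite (place_class pP Pu) (place_class pQ Qw).
apply/seteqP; split=> z /= [za ez]; split => //.
  exact: equivalent_trans (equivalent_sym (place_absolute_value pP Pu) e) ez.
exact: equivalent_trans e ez.
Qed.

Lemma place_nontrivial P u : place P -> P u -> nontrivial u.
Proof.
move=> [u0 [ua0 [x x0 ux] ->]] [ua [s s0 E]]; exists x => //.
rewrite E; apply: contra ux => /eqP h.
have u0x : 0 < u0 x by rewrite av_gt0.
have : ln (u0 x `^ s) = 0 by rewrite h ln1.
rewrite ln_powR => /eqP; rewrite mulf_eq0 gt_eqF //= ln_eq0 //.
Qed.

Lemma place_exists_gt1 P u : place P -> P u -> exists2 y, y != 0 & 1 < u y.
Proof.
move=> pP Pu; have ua := place_absolute_value pP Pu.
have [x x0 ux] := place_nontrivial pP Pu.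
case: (ltgtP (u x) 1) ux => // h _; last by exists x.
exists x^-1; first by rewrite invr_eq0.
by rewrite avV // invf_gt1 // av_gt0.
Qed.

(** An element z of order 0 satisfies u z = 1, since both z and its inverse lie
    in the valuation ring of v.  Hence u z = u t ^ (v z), with t of order 1. *)
Lemma equivalent_of_le1 u v c : 0 < c < 1 -> absolute_value u -> nontrivial u ->
  normalized_valuation v -> (forall z, z != 0 -> 0 <= v z -> u z <= 1) ->
  equivalent (vabs c v) u.
Proof.
move=> /andP[c0 c1] ua [x1 x10 ux1] vn le1.
have [_ _ _ /(_ 1)[t t0 vt]] := vn.
have ut0 : 0 < u t by rewrite av_gt0.
have vv := normalized_valuationW vn.
have unit1 z : z != 0 -> v z = 0 -> u z = 1.
  move=> z0 vz; apply/eqP; rewrite eq_le le1 ?vz //=.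
  have : u z^-1 <= 1 by rewrite le1 ?invr_eq0 // (valuationV vv) // vz.
  by rewrite avV // invf_le1 // av_gt0.
have uX z n : z != 0 -> u (z ^ n) = u z ^ n.
  move=> z0; case: n => n; first by rewrite -exprnP avX.
  by rewrite NegzE -!exprz_inv -!exprnP avX // avV.
have uE z : z != 0 -> u z = u t ^ (v z).
  move=> z0; have tz0 : t ^ (v z) != 0 by rewrite expfz_neq0.
  have : u (z / t ^ (v z)) = 1.
    apply: unit1; rewrite ?mulf_neq0 ?invr_eq0 // (valuationM vv) ?invr_eq0 //.
    by rewrite (valuationV vv) // (valuationXz vv) // vt mul1r subrr.
  by rewrite avM // avV // uX // => /divr1_eq.
have ut1 : u t < 1.
  rewrite lt_neqAle le1 ?vt // andbT; apply: contraNneq ux1 => ut.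
  by rewrite uE // ut exp1rz.
pose s := ln (u t) / ln c.
have lnc : ln c < 0 by rewrite ln_lt0 // c0.
have lnut : ln (u t) < 0 by rewrite ln_lt0 // ut0.
exists s; first by rewrite /s nmulr_rgt0 // invr_lt0.
move=> z; rewrite /vabs; case: eqP => [->|/eqP z0].
  by rewrite av0 // powR0 // /s mulf_neq0 ?invr_eq0 ?lt_eqF.
have cs : c `^ s = u t.
  apply: ln_inj; rewrite ?posrE ?powR_gt0 //.
  by rewrite ln_powR /s divfK // lt_eqF.
rewrite uE // -(powR_intmul _ (ltW c0)) -powRrM mulrC powRrM cs.
by rewrite powR_intmul // ltW.
Qed.

(** By [equivalent_of_le1] the valuation ring of v is not contained in that of
    u; the converse inclusion fails too, as it would make v vanish at some z1
    with 1 < u z1, and then y / z1 ^ N with v y < 0 would contradict it for N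
    large.  A quotient of two witnesses separates u from v. *)
Lemma separating_element u v c : 0 < c < 1 -> ultrametric u -> nontrivial u ->
  normalized_valuation v -> ~ equivalent (vabs c v) u ->
  exists2 z, 1 < u z & vabs c v z < 1.
Proof.
move=> c01 uu unt vn neq; have ua := uu.1.
have wu := vabs_ultrametric c01 (normalized_valuationW vn); have wa := wu.1.
set w := vabs c v in neq wu wa *.
have [z1 z1u z1w] : exists2 z, 1 < u z & w z <= 1.
  apply: contrapT => H; apply: neq; apply: equivalent_of_le1 => // z z0 vz.
  by rewrite leNgt; apply/negP => uz; apply: H; exists z => //; rewrite vabs_le1.
have nz1 : z1 != 0 by rewrite -(av_gt0 ua); apply: lt_trans z1u.
have [z2 z2u z2w] : exists2 z, u z <= 1 & 1 < w z.
  apply: contrapT => H.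
  have le z : u z <= 1 -> w z <= 1.
    by move=> uz; rewrite leNgt; apply/negP => wz; apply: H; exists z.
  have wz1 : w z1 = 1.
    apply/eqP; rewrite eq_le z1w /=.
    have : w z1^-1 <= 1 by apply: le; rewrite avV // invf_le1 ?ltW // av_gt0.
    by rewrite avV // invf_le1 // av_gt0.
  have [y y0 vy] : exists2 y, y != 0 & v y = -1 by case: vn => _ _ _ /(_ (-1)).
  have wy : 1 < w y by rewrite vabs_gt1 // vy.
  have [N /(_ N (leqnn N)) NP] := exp_unbounded z1u (av_ge0 ua y).
  have : w (y / z1 ^+ N) <= 1.
    apply: le; rewrite av_div // avX // ler_pdivrMr ?mul1r ?ltW //.
    by rewrite exprn_gt0 // av_gt0.
  by rewrite av_div // avX // wz1 expr1n divr1 leNgt wy.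
exists (z1 / z2); rewrite av_div //.
  have u2 : 0 < u z2 by rewrite av_gt0 // -(av_gt0 wa); apply: lt_trans z2w.
  by rewrite ltr_pdivlMr // mul1r; apply: le_lt_trans z1u.
by rewrite ltr_pdivrMr ?mul1r; [apply: le_lt_trans z2w|apply: lt_trans z2w].
Qed.

(** Induction on the number of absolute values: z is large at u and small at
    the first r of them, and y is large at u and small at the last one.  If
    z is at most 1 at the last one, take z ^ N * y.  Otherwise take
    z ^ N / (1 + z ^ N) * y, since z ^ N / (1 + z ^ N) has absolute value 1
    where z is large, and behaves as z ^ N where z is small.  The predicate J
    selects the absolute values to be considered. *)
Lemma weak_approximation_gt1 u (w : nat -> K -> R) (J : pred nat) r :
  ultrametric u -> nontrivial u ->
  (forall i, (i < r)%N -> J i -> ultrametric (w i)) ->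
  (forall i, (i < r)%N -> J i -> exists2 z, 1 < u z & w i z < 1) ->
  exists2 e, 1 < u e & forall i, (i < r)%N -> J i -> w i e < 1.
Proof.
move=> uu [x0 x00 ux0]; have ua := uu.1.
elim: r => [|r IHr] wu sep.
  have [h|h] := ltP 1 (u x0); first by exists x0.
  exists x0^-1 => //; rewrite avV // invf_gt1 ?av_gt0 // lt_neqAle ux0 //.
have [||z zu zw] := IHr.
- by move=> i ir; apply: wu; rewrite ltnW.
- by move=> i ir; apply: sep; rewrite ltnW.
have z0 : z != 0 by rewrite -(av_gt0 ua); apply: lt_trans zu.
have [Jr|nJr] := boolP (J r); last first.
  exists z => // i; rewrite ltnS leq_eqVlt => /predU1P[->|]; first by rewrite (negPf nJr).
  exact: zw.
have [y yu yw] := sep r (ltnSn r) Jr.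
have y0 : y != 0 by rewrite -(av_gt0 ua); apply: lt_trans yu.
have wru := wu r (ltnSn r) Jr; have wra := wru.1.
have [N NP] : exists N, forall n, (N <= n)%N -> forall i, (i < r)%N -> J i ->
    w i z ^+ n < (if (i < r)%N && J i then (w i y)^-1 else 1).
  apply: (@exp_small_family _ r (fun i => w i z)) => [i ir Ji|i].
    by rewrite zw // andbT av_ge0 //; case: (wu i (ltnW ir) Ji).
  by case: ifP => // /andP[/ltnW ir Ji]; rewrite invr_gt0 av_gt0 //; case: (wu i ir Ji).
have small i : (i < r)%N -> J i -> w i (z ^+ N.+1 * y) < 1.
  move=> ir Ji; have wi := (wu i (ltnW ir) Ji).1.
  have := NP N.+1 (leqnSn N) i ir Ji; rewrite ir Ji avM // avX // => h.
  by rewrite -[1](mulVf (_ : w i y != 0)) ?ltr_pM2r ?av_gt0 ?av_eq0.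
have uzN : 1 < u (z ^+ N.+1) by rewrite avX // exprn_egt1.
have [wz|wz] := leP (w r z) 1.
  exists (z ^+ N.+1 * y); first by rewrite avM // mulr_egt1.
  move=> i; rewrite ltnS leq_eqVlt => /predU1P[-> _|]; last exact: small.
  rewrite avM // avX //; apply: le_lt_trans yw.
  by rewrite ler_piMl ?av_ge0 // exprn_ile1 ?av_ge0.
have wzN : 1 < w r (z ^+ N.+1) by rewrite avX // exprn_egt1.
exists (z ^+ N.+1 / (1 + z ^+ N.+1) * y).
  rewrite avM // av_div // addrC ultra_dominant ?av1 // divff ?mul1r //.
  by rewrite gt_eqF //; apply: lt_trans uzN.
move=> i; rewrite ltnS leq_eqVlt => /predU1P[-> _|Hi Ji].
  rewrite avM // av_div // addrC ultra_dominant ?av1 // divff ?mul1r //.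
  by rewrite gt_eqF //; apply: lt_trans wzN.
have wiu := wu i (ltnW Hi) Ji; have wia := wiu.1.
have d1 : w i (1 + z ^+ N.+1) = 1.
  rewrite -[RHS](av1 wia); apply: ultra_dominant => //.
  by rewrite (av1 wia) avX // exprn_ilt1 ?av_ge0 ?zw.
by rewrite mulrAC av_div // d1 divr1; apply: small.
Qed.

Lemma weak_approximation u (w : nat -> K -> R) (J : pred nat) r (eps : nat -> R) :
  ultrametric u -> nontrivial u ->
  (forall i, (i < r)%N -> J i -> ultrametric (w i)) ->
  (forall i, (i < r)%N -> J i -> exists2 z, 1 < u z & w i z < 1) ->
  (forall i, 0 < eps i) ->
  exists2 e, u e = 1 & forall i, (i < r)%N -> J i -> w i e < eps i.
Proof.
move=> uu unt wu sep eps0; have ua := uu.1.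
have [z zu zw] := weak_approximation_gt1 uu unt wu sep.
pose e := z / (1 + z).
have ue : u e = 1.
  rewrite /e av_div // addrC ultra_dominant ?av1 // divff //.
  by rewrite gt_eqF //; apply: lt_trans zu.
have we i : (i < r)%N -> J i -> w i e = w i z.
  move=> ir Ji; have wi := wu i ir Ji.
  have wia := wi.1; have d1 : w i (1 + z) = 1.
    by rewrite -[RHS](av1 wia); apply: ultra_dominant; rewrite // (av1 wia) zw.
  by rewrite /e av_div // d1 divr1.
have [|N NP] := @exp_small_family _ r (fun i => w i e) eps J _ eps0.
  by move=> i ir Ji; rewrite we // zw // andbT av_ge0 //; case: (wu i ir Ji).
exists (e ^+ N); first by rewrite avX // ue expr1n.
by move=> i ir Ji; rewrite avX ?NP //; case: (wu i ir Ji).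
Qed.

End Places.

(** * Places at infinity *)

Section PolesOfY.
Variables (R : realType) (F : finFieldType) (K : fieldType).
Variables (phi : {rmorphism F -> K}) (y : K).
Hypothesis yfin : finite_over phi y.
Let ev := eval_at phi y.
Implicit Types (u w : K -> R) (P Q : set (K -> R)).

Lemma finite_constants_pchar : exists p, p \in [pchar K].
Proof.
have [p _ pF] := finPcharP F.
by exists p; rewrite (fmorph_pchar phi).
Qed.

Lemma av_nonarchimedean u : absolute_value u -> ultrametric u.
Proof.
move=> ua; split => //.
by have [p /nonarchimedean_pchar] := finite_constants_pchar; exact.
Qed.

Definition pole_place P := place P /\ pord P y < 0.

Lemma y_neq0 : y != 0.
Proof.
have := @eval_at_inj _ _ phi y (finite_over_is_transcendental yfin).
move=> /inj_eq/(_ 'X 0); rewrite rmorph0 polyX_eq0 eval_atE map_polyX hornerX.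
by move=> ->.
Qed.

Lemma pole_placeP P : pole_place P -> exists w, [/\ P w, ultrametric w, 1 < w y &
  exists2 c : R, 0 < c < 1 & w = vabs c (pord P) /\ normalized_valuation (pord P)].
Proof.
move=> [pP Py]; have [E|[nP [c c01 Pw]]] := pord_cases P; first by rewrite E ltxx in Py.
exists (vabs c (pord P)); split => //.
- exact/vabs_ultrametric/normalized_valuationW.
- by rewrite vabs_gt1 // y_neq0.
- by exists c.
Qed.

Lemma separating_place P Q u : place P -> P u -> pole_place Q -> Q <> P ->
  forall w c, 0 < c < 1 -> normalized_valuation (pord Q) -> Q w -> w = vabs c (pord Q) ->
  exists2 z, 1 < u z & w z < 1.
Proof.
move=> pP Pu [pQ Qy] QP w c c01 nQ Qw wE; rewrite wE.
apply: separating_element => //.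
- exact/av_nonarchimedean/(place_absolute_value pP Pu).
- exact: place_nontrivial pP Pu.
- by rewrite -wE => e; apply: QP; apply: place_eq pQ pP Qw Pu e.
Qed.

(** There are at most n = [K : F(y)] of them.  Otherwise choose, for n + 1 of
    them, elements e_j of absolute value 1 at the j-th one and less than 1 at
    the others.  In a linear relation between the e_j over F[y], the term whose
    coefficient has the largest degree dominates at the corresponding place. *)
Lemma finite_poles : finite_set pole_place.
Proof.
have [n [dep _]] := finite_over_rank yfin.
apply: contrapT => /infiniteP/pcard_leP/unsquash Q0.
pose Q (i : nat) : set (K -> R) := Q0 i.
have Qpole i : pole_place (Q i) by apply: (@funS _ _ _ _ Q0).
have Qinj i j : Q i = Q j -> i = j.
  by move=> E; apply: (@inj _ _ _ Q0); rewrite ?in_setT.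
have /choice[w wP] := fun i => pole_placeP (Qpole i).
have sep i j : i != j -> exists2 z, 1 < w i z & w j z < 1.
  move=> ij; have [Pw uw _ _] := wP i; have [Pw' _ _ [c c01 [wE nQ]]] := wP j.
  apply: (separating_place (Qpole i).1 Pw (Qpole j) _ c01 nQ Pw' wE).
  by move=> /Qinj ji; rewrite ji eqxx in ij.
have /choice[e eP] : forall j, exists e, w j e = 1 /\
    forall i, (i < n.+1)%N -> i != j -> w i e < 1.
  move=> j; have [Pw uw _ _] := wP j.
  have unt := place_nontrivial (Qpole j).1 Pw.
  have [|||e e1 ew] := @weak_approximation R K (w j) w (fun i => i != j) n.+1
      (fun=> 1) uw unt.
  - by move=> i _ _; case: (wP i).
  - by move=> i _ ij; apply: sep; rewrite eq_sym.
  - by [].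
  by exists e.
have [g [[j1 gj1] gsum]] := dep (fun j : 'I_n.+1 => e j).
pose j0 := [arg max_(j > j1) size (g j)].
have j0max j : (size (g j) <= size (g j0))%N.
  by rewrite /j0; case: arg_maxnP => // i _ /(_ j); apply.
have gj0 : g j0 != 0.
  by rewrite -size_poly_gt0; apply: leq_trans (j0max j1); rewrite size_poly_gt0.
have [_ uw wy _] := wP j0; have wa := uw.1.
have : w j0 (ev (g j0) * e j0) = w j0 y ^+ (size (g j0)).-1.
  by rewrite avM // (eP j0).1 mulr1 ultra_eval.
have : w j0 (ev (g j0) * e j0) < w j0 y ^+ (size (g j0)).-1.
  move: gsum; rewrite (bigD1 j0) //= => /eqP; rewrite addr_eq0 => /eqP ->.
  have y0 : 0 < w j0 y by apply: lt_trans wy.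
  rewrite avN //; apply: ultra_sum_lt => //; first by rewrite exprn_gt0.
  move=> j jj0; have [->|gj] := eqVneq (g j) 0.
    by rewrite rmorph0 mul0r av0 // exprn_gt0.
  rewrite avM // ultra_eval //.
  have ej : w j0 (e j) < 1 by apply: (eP j).2 => //; rewrite eq_sym.
  apply: lt_le_trans (_ : w j0 y ^+ (size (g j)).-1 <= _).
    by rewrite gtr_pMr // exprn_gt0.
  by rewrite ler_eXn2l // -!subn1 leq_sub2r.
by move=> h E; rewrite E ltxx in h.
Qed.

End PolesOfY.

(** * Reduction modulo powers of 1 / y *)

(** A subspace of largest dimension contained in P is all of P. *)
Lemma subspace_of_pred (F : fieldType) (V : vectType F) (P : V -> Prop) :
  P 0 -> (forall a x y, P x -> P y -> P (a *: x + y)) ->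
  exists U : {vspace V}, forall x, x \in U <-> P x.
Proof.
move=> P0 Plin.
pose sub (U : {vspace V}) := forall x, x \in U -> P x.
have exd : exists d, `[< exists U, sub U /\ \dim U = d >].
  exists 0%N; apply/asboolP; exists 0%VS; split; last by rewrite dimv0.
  by move=> x; rewrite memv0 => /eqP ->.
have bd d : `[< exists U, sub U /\ \dim U = d >] -> (d <= \dim {:V})%N.
  by move=> /asboolP[U [_ <-]]; apply/dimvS/subvf.
case: (ex_maxnP exd bd) => d /asboolP[U [subU dU]] dmax.
exists U => x; split; first exact: subU.
move=> Px; apply: contrapT => /negP xU.
have subUx : sub (<[x]> + U)%VS.
  move=> z /memv_addP[_ /vlineP[a ->] [b bU ->]].
  by apply: Plin => //; apply: subU.
have /dmax : `[< exists U', sub U' /\ \dim U' = \dim (<[x]> + U)%VS >].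
  by apply/asboolP; exists (<[x]> + U)%VS.
rewrite leqNgt -dU; case/negP.
have [//|] := eqVneq U (<[x]> + U)%VS.
  by move=> E; case/negP: xU; rewrite E; apply: (subvP (addvSl _ _)); exact: memv_line.
move=> ne; rewrite ltn_neqAle dimvS ?addvSr // andbT.
by apply: contra ne => /eqP; move/eqP; rewrite eqEdim addvSr => /eqP ->; rewrite leqnn.
Qed.

Section Reduction.
Variables (R : realType) (F : finFieldType) (K : fieldType).
Variables (phi : {rmorphism F -> K}) (y : K) (n : nat).
Let ev := eval_at phi y.
Hypothesis dep : forall e : 'I_n.+1 -> K, exists g : 'I_n.+1 -> {poly F},
     (exists j, g j != 0) /\ \sum_j ev (g j) * e j = 0.
Variable W : (K -> R) -> Prop.
Hypothesis W_ultra : forall w, W w -> ultrametric w.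
Hypothesis W_pole : forall w, W w -> 1 < w y.

(** The common valuation ring at infinity, modulo 1 / y, has dimension at most n
    over F: in a relation with polynomial coefficients, the coefficients of the
    highest power y ^ d give a relation modulo 1 / y. *)
Lemma reduction_dependent (x : 'I_n.+1 -> K) :
  (forall w, W w -> forall j, w (x j) <= 1) ->
  exists c : 'I_n.+1 -> F, (exists j, c j != 0) /\
    forall w, W w -> w (\sum_j phi (c j) * x j) <= (w y)^-1.
Proof.
move=> x1; have [g [[j1 gj1] gsum]] := dep x.
pose j0 := [arg max_(j > j1) size (g j)].
have j0max j : (size (g j) <= size (g j0))%N.
  by rewrite /j0; case: arg_maxnP => // i _ /(_ j); apply.
have gj0 : g j0 != 0.
  by rewrite -size_poly_gt0; apply: leq_trans (j0max j1); rewrite size_poly_gt0.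
have [d sd] : exists d, size (g j0) = d.+1.
  by exists (size (g j0)).-1; rewrite prednK // size_poly_gt0.
exists (fun j => (g j)`_d); split.
  by exists j0; have := lead_coef_eq0 (g j0); rewrite lead_coefE sd /= => ->.
move=> w Ww; have wu := W_ultra Ww; have wa := wu.1; have wy := W_pole Ww.
have y0 : 0 < w y by apply: lt_trans wy.
have gE j : ev (g j) = phi (g j)`_d * y ^+ d + ev (take_poly d (g j)).
  have {1}-> : g j = ((g j)`_d)%:P * 'X^d + take_poly d (g j).
    have <- : drop_poly d (g j) = ((g j)`_d)%:P.
      apply/polyP => i; rewrite coef_drop_poly coefC.
      case: i => [|i] //=; rewrite nth_default //.
      by apply: leq_trans (j0max j) _; rewrite sd; lia.
    by rewrite addrC poly_take_drop.
  rewrite rmorphD rmorphM rmorphXn /= /ev !eval_atE.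
  by rewrite map_polyC map_polyX hornerC hornerX.
have E : y ^+ d * (\sum_j phi (g j)`_d * x j) = - \sum_j ev (take_poly d (g j)) * x j.
  apply/eqP; rewrite -addr_eq0 -[X in _ == X]gsum mulr_sumr -big_split /=.
  by apply/eqP/eq_bigr => j _; rewrite gE; ring.
rewrite -(ler_pM2l (exprn_gt0 d y0)) -avX // -avM // E avN //.
apply: ultra_sum_le => //; first by rewrite mulr_ge0 ?exprn_ge0 ?invr_ge0 ?av_ge0.
move=> j _; rewrite avM // avX //.
apply: le_trans (_ : w (ev (take_poly d (g j))) <= _).
  by rewrite ler_piMr ?av_ge0 // x1.
have := size_take_poly d (g j); case: {E gE}d sd => [|d] sd.
  by rewrite leqn0 size_poly_eq0 => /eqP ->; rewrite rmorph0 av0 // mul1r invr_ge0 ltW.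
move=> st; rewrite exprSr mulfK ?gt_eqF //.
exact: ultra_eval_le.
Qed.

Definition comb d (z : 'I_d -> K) (c : 'rV[F]_d) := \sum_i phi (c 0 i) * z i.

Lemma combP d (z : 'I_d -> K) a c c' :
  comb z (a *: c + c') = phi a * comb z c + comb z c'.
Proof.
rewrite /comb mulr_sumr -big_split; apply: eq_bigr => i _ /=.
by rewrite !mxE rmorphD rmorphM mulrDl mulrA.
Qed.

Lemma comb0 d (z : 'I_d -> K) : comb z 0 = 0.
Proof. by rewrite /comb big1 // => i _; rewrite mxE rmorph0 mul0r. Qed.

Lemma comb_sum d (z : 'I_d -> K) m (a : 'I_m -> F) (b : 'I_m -> 'rV[F]_d) :
  comb z (\sum_j a j *: b j) = \sum_j phi (a j) * comb z (b j).
Proof.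
elim/big_rec2: _ => [|j x c _ <-]; first exact: comb0.
by rewrite combP.
Qed.

(** Iterating [reduction_dependent], each step from y ^ -T to y ^ -(T + 1) costs
    at most n dimensions. *)
Lemma small_combinations d (z : 'I_d -> K) T :
  (forall w, W w -> forall i, w (z i) <= 1) ->
  exists U : {vspace 'rV[F]_d}, (d <= \dim U + n * T)%N /\
    forall c, c \in U -> forall w, W w -> w (comb z c) <= (w y) ^- T.
Proof.
move=> z1; elim: T => [|T [U [dU UT]]].
  exists fullv; rewrite dimvf /dim /= mul1n muln0 addn0; split => // c _ w Ww.
  have wu := W_ultra Ww; have wa := wu.1.
  rewrite expr0 invr1; apply: ultra_sum_le => // i _.
  by rewrite avM // mulr_ile1 ?av_ge0 ?av_finite_le1 ?z1.
have [||V VP] := @subspace_of_pred F 'rV[F]_d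
    (fun c => forall w, W w -> w (comb z c) <= (w y) ^- T.+1).
- move=> w Ww; have wa := (W_ultra Ww).1.
  by rewrite comb0 av0 // invr_ge0 exprn_ge0 // av_ge0.
- move=> a c c' hc hc' w Ww; have wu := W_ultra Ww; have wa := wu.1.
  rewrite combP; apply: ultra_le => //; last exact: hc'.
  rewrite avM //; apply: le_trans (hc w Ww).
  by rewrite ler_piMl ?av_ge0 ?av_finite_le1.
exists (U :&: V)%VS; split; last first.
  by move=> c; rewrite memv_cap => /andP[_ /VP].
rewrite leqNgt; apply/negP => lt.
(* If the dimension dropped by more than n, then a complement of V in U would
   contain n + 1 independent vectors, hence by [reduction_dependent] a nonzero
   element of V. *)
have dC : (n < \dim (U :\: V))%N.
  by have := dimv_cap_compl U V; rewrite mulnS in lt; lia.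
pose b (j : 'I_n.+1) := (vbasis (U :\: V))`_j.
have bC j : b j \in (U :\: V)%VS.
  by apply: vbasis_mem; rewrite mem_nth // size_tuple; apply: leq_trans (ltn_ord j) _.
have bU j : b j \in U by apply: (subvP (diffvSl U V)).
have [|a [[j0 aj0] aP]] := @reduction_dependent (fun j => y ^+ T * comb z (b j)).
  move=> w Ww j; have wa := (W_ultra Ww).1.
  have y0 : 0 < w y by apply: lt_trans (W_pole Ww).
  rewrite avM // avX // -(ler_pM2l (_ : 0 < (w y) ^- T)) ?invr_gt0 ?exprn_gt0 //.
  by rewrite mulKf ?mulr1 ?gt_eqF ?exprn_gt0 // UT.
pose c := \sum_j a j *: b j.
have cC : c \in (U :\: V)%VS by apply: memv_suml => j _; apply: memvZ.
have cV : c \in V.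
  apply/VP => w Ww; have wa := (W_ultra Ww).1.
  have y0 : 0 < w y by apply: lt_trans (W_pole Ww).
  rewrite -(ler_pM2l (exprn_gt0 T y0)) exprSr invfM mulrA.
  rewrite divff ?gt_eqF ?exprn_gt0 // mul1r -avX // -avM //.
  have -> : y ^+ T * comb z c = \sum_j phi (a j) * (y ^+ T * comb z (b j)).
    by rewrite comb_sum mulr_sumr; apply: eq_bigr => j _; ring.
  exact: aP.
have c0 : c = 0.
  by apply/eqP; rewrite -memv0 -(capv_diff U V) memv_cap cC.
have /freeP/(_ (fun i => if (i < n.+1)%N then a (inord i) else 0)) fr :=
  basis_free (vbasisP (U :\: V)).
have : a j0 = 0.
  have lt0 : (j0 < \dim (U :\: V))%N by apply: leq_trans (ltn_ord j0) _.
  rewrite -[LHS](_ : (if (Ordinal lt0 < n.+1)%N then a (inord (Ordinal lt0)) else 0) = _).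
    apply: fr; rewrite -[RHS]c0 /c.
    transitivity (\sum_(i < n.+1) a (inord i) *: (vbasis (U :\: V))`_i); last first.
      by apply: eq_bigr => j _; rewrite inord_val.
    rewrite (big_ord_widen _ (fun i => a (inord i) *: (vbasis (U :\: V))`_i) dC).
    rewrite [RHS]big_mkcond /=; apply: eq_bigr => i _.
    by case: ifP => // _; rewrite scale0r.
  by rewrite /= ltn_ord inord_val.
by move/eqP: aj0.
Qed.

End Reduction.

(** * Functions with a single pole *)

Section OnePole.
Variables (R : realType) (F : finFieldType) (K : fieldType).
Variables (phi : {rmorphism F -> K}) (y : K).
Hypothesis yfin : finite_over phi y.
Let ev := eval_at phi y.
Implicit Types (u w : K -> R) (P Q : set (K -> R)).

Lemma uniform_growth (I : finType) r (w : nat -> K -> R) (om : I -> K) :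
  (forall i, (i < r)%N -> ultrametric (w i)) -> (forall i, (i < r)%N -> 1 < w i y) ->
  exists M, forall i, (i < r)%N -> forall j, w i (om j) <= w i y ^+ M.
Proof.
move=> wu wy.
have [|i|M MP] := @exp_small_family R r (fun i => (w i y)^-1)
   (fun i => (if (i < r)%N then 1 + \sum_j w i (om j) else 1)^-1) xpredT.
- move=> i ir _; have y0 : 0 < w i y by apply: lt_trans (wy i ir).
  by rewrite invr_ge0 ltW //= invf_lt1 // wy.
- rewrite invr_gt0; case: ifP => // ir.
  by apply: ltr_wpDr => //; apply: sumr_ge0 => j _; apply: av_ge0 (wu i ir).1 _.
exists M => i ir j; have wa := (wu i ir).1.
have y0 : 0 < w i y by apply: lt_trans (wy i ir).
have s0 : 0 <= \sum_j w i (om j) by apply: sumr_ge0 => k _; apply: av_ge0.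
have := MP M (leqnn M) i ir isT.
rewrite ir exprVn ltf_pV2 ?posrE ?exprn_gt0 //; last first.
  by apply: ltr_wpDr.
move=> h; apply: ltW; apply: le_lt_trans h.
rewrite (bigD1 j) //= addrCA lerDl addr_ge0 //.
by apply: sumr_ge0 => k _; apply: av_ge0.
Qed.

(** Let e be a unit at P that is very small at the other poles of y.  The n N
    functions y ^ (a + 1) om_i and the T functions e y ^ (t + 1) all lie in
    y ^ T times the common valuation ring at infinity, where T = N + M.  If N is
    large then n N + T > n T, so that by [small_combinations] some nontrivial
    combination y b + e H(y) of them is regular at all the poles of y.  At those
    other than P, e H(y) is regular, hence so is y b.  If b = 0, then H is
    nonzero and e H(y) has a pole at P, a contradiction.  Finally b is integral
    over F[y], so y b has no pole where y has none, and is not a constant. *)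
Lemma exists_pole_only_at P u : place P -> P u -> 1 < u y ->
  exists2 x, transcendental phi x &
    forall Q : set (K -> R), place Q -> Q <> P -> 0 <= pord Q x.
Proof.
move=> pP Pu uy; have uu := av_nonarchimedean phi (place_absolute_value pP Pu).
have unt := place_nontrivial pP Pu; have ua := uu.1.
have y0 := y_neq0 yfin.
have [n [dep [om [om_int om_free]]]] := finite_over_rank yfin.
have [s sE] : exists s : seq (set (K -> R)), (@pole_place R K y `\ P) = [set` s].
  apply/finite_seqP; have fin := finite_poles R yfin.
  by apply: sub_finite_set fin => Q [].
pose r := size s; pose Q i := nth P s i.
have Qpole i : (i < r)%N -> pole_place y (Q i) /\ Q i <> P.
  move=> ir; have : [set` s] (Q i) by apply: mem_nth.
  by rewrite -sE => -[].
have /choice[w wP] : forall i, exists w, (i < r)%N -> [/\ Q i w, ultrametric w, 1 < w y,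
    (exists2 c : R, 0 < c < 1 & w = vabs c (pord (Q i))) & exists2 z, 1 < u z & w z < 1].
  move=> i; have [ir|//] := boolP (i < r)%N; last by exists u.
  have [Qi QiP] := Qpole i ir.
  have [w [Qw uw wy [c c01 [wE nQ]]]] := pole_placeP yfin Qi.
  exists w => _; split => //; first by exists c.
  exact: (separating_place phi pP Pu Qi QiP c01 nQ Qw wE).
pose w' i := if i is j.+1 then w j else u.
have w'u i : (i < r.+1)%N -> ultrametric (w' i).
  by case: i => [|i] //=; rewrite ltnS => /wP[].
have w'y i : (i < r.+1)%N -> 1 < w' i y.
  by case: i => [|i] //=; rewrite ltnS => /wP[].
have [M MP] := uniform_growth om w'u w'y.
(* With this choice n * N + T - n * T = N + M - n * M is positive. *)
pose N := (n * M).+1; pose T := (N + M)%N.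
have [||i|e ue we] := @weak_approximation R K u w xpredT r
    (fun i => if (i < r)%N then (w i y) ^- T else 1) uu unt.
- by move=> i /wP[].
- by move=> i /wP[].
- by case: ifP => // /wP[_ _ wy _ _]; rewrite invr_gt0 exprn_gt0 //; apply: lt_trans wy.
pose W v := exists2 i, (i < r.+1)%N & v = w' i.
have W_ultra v : W v -> ultrametric v by case=> i ir ->; exact: w'u.
have W_pole v : W v -> 1 < v y by case=> i ir ->; exact: w'y.
have We v : W v -> v e <= 1.
  case=> -[|i] ir -> /=; first by rewrite ue.
  rewrite ltnS in ir; have [_ _ wy _ _] := wP i ir.
  apply: ltW; apply: lt_le_trans (we i ir isT) _.
  by rewrite ir invf_le1 ?exprn_gt0 ?(lt_trans _ wy) // exprn_ege1 // ltW.
pose I : finType := ('I_N * 'I_n + 'I_T)%type.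
pose z0 (j : I) : K := match j with
  | inl p => y ^+ p.1.+1 * om p.2 | inr t => e * y ^+ t.+1 end.
pose z (j : 'I_#|I|) := z0 (enum_val j) / y ^+ T.
have z1 v : W v -> forall j, v (z j) <= 1.
  move=> Wv j; have vu := W_ultra v Wv; have va := vu.1; have vy := W_pole v Wv.
  have vy0 : 0 < v y by apply: lt_trans vy.
  rewrite /z; rewrite av_div // avX // ler_pdivrMr ?exprn_gt0 // mul1r.
  case: (enum_val j) => [[a i]|t] /=; rewrite avM // avX //.
    apply: le_trans (_ : v y ^+ N * v y ^+ M <= _); last by rewrite -exprD.
    apply: ler_pM; rewrite ?exprn_ge0 ?av_ge0 //; first by rewrite ler_eXn2l.
    by case: Wv => k kr ->; apply: MP.
  apply: le_trans (_ : 1 * v y ^+ T <= _); last by rewrite mul1r.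
  by apply: ler_pM; rewrite ?exprn_ge0 ?av_ge0 ?We // ler_eXn2l.
have [U [dU UP]] := small_combinations dep W_ultra W_pole T z1.
have U0 : U != 0%VS.
  apply: contraTneq dU => ->; rewrite dimv0 add0n -ltnNge.
  rewrite card_sum card_prod !card_ord /T /N; lia.
pose c0 := vpick U; pose c (j : I) := c0 0 (enum_rank j).
have c0P v : W v -> v (\sum_(j : I) phi (c j) * z0 j) <= 1.
  move=> Wv; have va := (W_ultra v Wv).1.
  have vy0 : 0 < v y by apply: lt_trans (W_pole v Wv).
  have : v (comb phi z c0) <= v y ^- T by apply: UP => //; exact: memv_pick.
  have -> : comb phi z c0 = (\sum_(j : I) phi (c j) * z0 j) / y ^+ T.
    rewrite /comb mulr_suml (reindex (@enum_rank I)) /=; last first.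
      exact/onW_bij/enum_rank_bij.
    by apply: eq_bigr => j _; rewrite /z enum_rankK mulrA.
  rewrite av_div // avX // ler_pdivrMr ?exprn_gt0 // mulVf //.
  by rewrite gt_eqF // exprn_gt0.
pose G i : {poly F} := \poly_(a < N) (if insub a is Some a' then c (inl (a', i)) else 0).
pose H : {poly F} := 'X * \poly_(t < T) (if insub t is Some t' then c (inr t') else 0).
pose b := \sum_i ev (G i) * om i.
have ev_poly m (f : 'I_m -> F) :
    ev (\poly_(a < m) (if insub a is Some a' then f a' else 0)) =
    \sum_(a < m) phi (f a) * y ^+ a.
  rewrite poly_def rmorph_sum; apply: eq_bigr => a _ /=.
  rewrite valK -mul_polyC rmorphM rmorphXn /= /ev !eval_atE.
  by rewrite map_polyC map_polyX hornerC hornerX.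
have evX : ev 'X = y by rewrite /ev eval_atE map_polyX hornerX.
have sumE : \sum_(j : I) phi (c j) * z0 j = y * b + e * ev H.
  rewrite big_sumType /=; congr (_ + _).
    rewrite mulr_sumr.
    transitivity (\sum_(a < N) \sum_(i < n) phi (c (inl (a, i))) * (y ^+ a.+1 * om i)).
      by rewrite pair_bigA; apply: eq_bigr => -[a i] _.
    rewrite exchange_big; apply: eq_bigr => i _ /=.
    rewrite /G ev_poly mulr_suml mulr_sumr; apply: eq_bigr => a _.
    by rewrite exprS; ring.
  rewrite /H rmorphM ev_poly evX !mulr_sumr; apply: eq_bigr => t _.
  by rewrite exprS; ring.
have vH v : W v -> v (ev H) <= v y ^+ T.
  move=> Wv; apply: ultra_eval_le; [exact: W_ultra|exact: W_pole|].
  rewrite /H mulrC; apply: leq_trans (size_polyMleq _ _) _.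
  by rewrite size_polyX addn2 /= ltnS size_poly.
have b_reg i : (i < r)%N -> w i (y * b) <= 1.
  move=> ir; have Wi : W (w i) by exists i.+1.
  have wu := W_ultra _ Wi; have wa := wu.1.
  have yi : 0 < w i y by apply: lt_trans (W_pole _ Wi).
  rewrite -(addrK (e * ev H) (y * b)) -sumE; apply: ultra_le => //; first exact: c0P.
  rewrite avN // avM //; apply: le_trans (_ : w i y ^- T * w i y ^+ T <= _).
    apply: ler_pM; rewrite ?av_ge0 ?vH //.
    by have := we i ir isT; rewrite ir => /ltW.
  by rewrite mulVf // gt_eqF // exprn_gt0.
have b0 : b != 0.
  apply/eqP => b0.
  have G0 := om_free G b0.
  have cl a i : c (inl (a, i)) = 0.
    have := congr1 (fun p : {poly F} => p`_a) (G0 i).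
    by rewrite coef_poly ltn_ord valK coef0.
  pose H1 : {poly F} := \poly_(t < T) (if insub t is Some t' then c (inr t') else 0).
  have H1_0 : H1 != 0.
    apply/eqP => H10.
    have cr t : c (inr t) = 0.
      have := congr1 (fun p : {poly F} => p`_t) H10.
      by rewrite coef_poly ltn_ord valK coef0.
    have : c0 = 0.
      apply/rowP => j; rewrite mxE -[j]enum_valK.
      by rewrite -[LHS]/(c (enum_val j)); case: (enum_val j) => [[a i]|t].
    by move/eqP; rewrite vpick0 (negPf U0).
  have Wu : W u by exists 0%N.
  have := c0P u Wu; rewrite sumE b0 mulr0 add0r avM // ue mul1r.
  rewrite ultra_eval ?mulf_neq0 ?polyX_eq0 // /H mulrC size_mulX //=.
  by apply/negP; rewrite -ltNge exprn_egt1 // size_poly_eq0; exact: H1_0.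
exists (y * b).
  apply: transcendental_mul_integral => //.
  rewrite /b; elim/big_ind: _ => [||i _]; [exact: integral0|exact: integral_add|].
  by apply: integral_mul; [exact: integral_id|exact: om_int].
move=> Q' pQ QP.
have [->//|[nQ [c1 c01 Qw]]] := pord_cases Q'.
have b'0 : y * b != 0 by rewrite mulf_neq0.
rewrite -(@vabs_le1 R K c1) //.
have vu := vabs_ultrametric c01 (normalized_valuationW nQ).
have [Qy|Qy] := ltP (pord Q' y) 0; last first.
  apply: (@ultra_integral R K _ vu _ ev).
    by move=> g; apply: ultra_eval_le1; rewrite // vabs_le1.
  rewrite /b mulr_sumr.
  elim/big_ind: _ => [||i _]; [exact: integral0|exact: integral_add|].
  rewrite -evX; apply: integral_mul; first exact: integral_id.
  by apply: integral_mul; [exact: integral_id|exact: om_int].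
have : (@pole_place R K y `\ P) Q' by [].
rewrite sE => /(nthP P)[i ir iE].
have := b_reg i ir; have [_ _ _ [c2 c02 ->] _] := wP i ir.
by rewrite /Q iE !vabs_le1.
Qed.

End OnePole.

(** * Prescribed residues *)

Lemma int_euclidean_norm : euclidean_norm (fun d : int => `|d|%N).
Proof.
split.
- move=> a b b0; exists (a %/ b)%Z, (a %% b)%Z; split; first exact: divz_eq.
  by right; rewrite -ltz_nat gez0_abs ?modz_ge0 // ltz_mod.
- by move=> a b a0 b0; rewrite abszM leq_pmull // absz_gt0.
- move=> a b a0 b0 aU; rewrite abszM ltn_Pmull ?absz_gt0 //.
  rewrite ltn_neqAle absz_gt0 a0 andbT eq_sym; apply: contra aU => /eqP a1.
  by rewrite unfold_in /= ; case: (intP a) a1 => [|n|n] //= [->].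
- move=> n; exists ([seq Posz i | i <- iota 0 n] ++ [seq - Posz i | i <- iota 0 n]).
  move=> d dn; rewrite mem_cat; apply/orP; case: (ger0P d) => d0; [left|right].
    by apply/mapP; exists `|d|%N; rewrite ?mem_iota // gez0_abs.
  by apply/mapP; exists `|d|%N; rewrite ?mem_iota // ltz0_abs // opprK.
- move=> s; exists (Posz (\max_(d <- s) `|d|%N).+1); apply/negP => h.
  have := @leq_bigmax_seq _ s xpredT (fun d : int => `|d|%N) _ h isT.
  by rewrite /= ltnn.
Qed.

Lemma poly_euclidean_norm (F : finFieldType) :
  euclidean_norm (fun p : {poly F} => size p).
Proof.
split.
- move=> a b b0; exists (a %/ b), (a %% b); split; first exact: divp_eq.
  by right; rewrite ltn_modp.
- move=> a b a0 b0; rewrite mulrC size_mul //; move: a0.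
  by rewrite -size_poly_gt0; case: (size a) => // n _; rewrite addnS leq_addr.
- move=> a b a0 b0 aU; rewrite mulrC size_mul //.
  have : size a != 1%N.
    apply: contra aU => sa; rewrite poly_unitE sa /= unitfE.
    have := lead_coef_eq0 a; rewrite lead_coefE (eqP sa) /= => ->.
    by [].
  move: a0; rewrite -size_poly_gt0; case: (size a) => [|[|n]] // _ _.
  by rewrite !addnS /= ltnS leq_addr.
- move=> n; exists [seq (rVpoly v : {poly F}) | v : 'rV[F]_n].
  move=> d dn; apply/mapP; exists (poly_rV d); first by rewrite mem_enum.
  by rewrite poly_rV_K // ltnW.
- move=> s; exists 'X^(\max_(d <- s) size (d : {poly F})); apply/negP => h.
  have := @leq_bigmax_seq _ s xpredT (fun d : {poly F} => size d) _ h isT.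
  by rewrite /= size_polyXn ltnn.
Qed.

Lemma intr_fraction_map : fraction_map (intr : int -> rat).
Proof.
split; first exact: intr_inj.
by move=> x; exists (numq x), (denq x); rewrite denq_neq0 divq_num_den.
Qed.

(** The values of v form a subgroup of Z, generated by its least positive
    element. *)
Lemma normalize_valuation (K : fieldType) (v : K -> int) t :
  valuation v -> t != 0 -> 0 < v t ->
  exists v', normalized_valuation v' /\
    exists2 e : int, 0 < e & forall x, x != 0 -> v x = e * v' x.
Proof.
move=> vv t0 vt.
have exn : exists n, `[< (0 < n)%N /\ exists2 x, x != 0 & v x = n%:Z >].
  exists `|v t|%N; apply/asboolP; split; first by lia.
  by exists t => //; rewrite gez0_abs // ltW.
case: (ex_minnP exn) => e /asboolP[e0 [p p0 vp]] emin.
have vdiv x : x != 0 -> v x = e%:Z * (v x %/ e%:Z)%Z.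
  move=> x0; have E := divz_eq (v x) e%:Z; set q := (v x %/ e%:Z)%Z in E *.
  have r0 : (v x %% e%:Z)%Z = 0.
    apply: contrapT => /eqP rn0; have rge : 0 <= (v x %% e%:Z)%Z by rewrite modz_ge0; lia.
    have rlt : (v x %% e%:Z)%Z < e%:Z by apply: ltz_pmod; lia.
    have : (e <= `|(v x %% e%:Z)%Z|)%N.
      apply: emin; apply/asboolP; split; first by rewrite absz_gt0.
      exists (x * p ^ (- q)); first by rewrite mulf_neq0 ?expfz_neq0.
      rewrite valuationM ?expfz_neq0 // valuationXz // vp gez0_abs //.
      by rewrite {1}E; ring.
    lia.
  by rewrite E r0 addr0 mulrC.
have eI (a b : int) : e%:Z * a = e%:Z * b -> a = b.
  by apply: mulfI; lia.
pose v' x := if x == 0 then 0 else (v x %/ e%:Z)%Z.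
have v'E x : x != 0 -> v x = e%:Z * v' x.
  by move=> x0; rewrite /v' (negPf x0); exact: vdiv.
exists v'; split; last by exists e%:Z.
split; first by rewrite /v' eqxx.
- by move=> x y x0 y0; apply: eI; rewrite mulrDr -!v'E ?mulf_neq0 // valuationM.
- move=> x y x0 y0 xy0; have := vv.2 x y x0 y0 xy0; rewrite !v'E //.
  by rewrite !ge_min !ler_pM2l.
- move=> n; exists (p ^ n); first by rewrite expfz_neq0.
  by apply: eI; rewrite -v'E ?expfz_neq0 // valuationXz // vp.
Qed.

Section ResidueValuation.
Variables (D : idomainType) (N : D -> nat) (k0 : fieldType).
Variables (iota : {rmorphism D -> k0}) (L : fieldExtType k0).
Variables (K : fieldType) (h : {rmorphism L -> K}).
Hypothesis normN : euclidean_norm N.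
Hypothesis frac : fraction_map iota.
Hypothesis h_bij : bijective h.
Let psi d := h (iota d)%:A.

(** Apply [residue_degree_one_valuation] to k-th roots of the elements of s, and
    to the inverses of the elements of t: an element whose inverse has a
    residue has nonpositive order. *)
Lemma valuation_with_residues (R : realType) (s t : seq K) k m : (0 < k)%N -> m != 0 ->
  exists v : K -> int, [/\ valuation v,
    forall d, d != 0 -> 0 <= v (psi d), v (psi m) = 0,
    exists2 pi, pi != 0 & 0 < v (psi pi) &
    (forall x, x \in s -> exists b, x = psi b ^+ k \/ 0 < v (x - psi b ^+ k)) /\
    (forall x, x \in t -> x != 0 -> v x <= 0)].
Proof.
move=> k0_gt0 m0; case: h_bij => h' h'K hK.
have [M [j [jA jroot]]] := adjoin_kth_roots [seq h' x | x <- s] k0_gt0.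
pose g x := j (h' x).
have gD x y : g (x + y) = g x + g y.
  by rewrite /g -rmorphD; congr (j _); apply: (can_inj h'K); rewrite rmorphD !hK.
have gM x y : g (x * y) = g x * g y.
  by rewrite /g -rmorphM; congr (j _); apply: (can_inj h'K); rewrite rmorphM !hK.
have g0 x : (g x == 0) = (x == 0).
  by rewrite /g fmorph_eq0 -(inj_eq (can_inj h'K)) hK rmorph0.
have gB x y : g (x - y) = g x - g y.
  by apply/eqP; rewrite eq_sym subr_eq -gD subrK.
have g1 : g 1 = 1 by rewrite /g -(rmorph1 h) h'K rmorph1.
have gX x n : g (x ^+ n) = g x ^+ n.
  by elim: n => [|n IHn]; rewrite ?expr0 ?g1 // !exprS gM IHn.
have gpsi d : g (psi d) = (iota d)%:A by rewrite /g /psi h'K jA.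
have /choice[beta betaP] : forall x, exists b, x \in s -> b ^+ k = g x.
  move=> x; have [xs|_] := boolP (x \in s); last by exists 0.
  by have [|b Eb] := jroot (h' x); [apply: map_f|exists b].
have [v [vv vD vm [pi pi0 vpi] vres]] :=
  residue_degree_one_valuation normN frac
    ([seq beta x | x <- s] ++ [seq (g x)^-1 | x <- t]) m0.
have psi0 d : d != 0 -> psi d != 0.
  by rewrite -g0 gpsi scaler_eq0 oner_eq0 orbF -(rmorph0 iota) (inj_eq frac.1).
exists (fun x => v (g x)); split.
- split=> [x y x0 y0|x y x0 y0 xy0]; first by rewrite gM valuationM ?g0.
  by rewrite gD; apply: vv.2; rewrite -?gD ?g0.
- by move=> d d0; rewrite gpsi; apply: vD.
- by rewrite gpsi.
- by exists pi => //; rewrite gpsi.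
have c01 : 0 < (2^-1 : R) < 1 by lra.
have wu := vabs_ultrametric c01 vv; set w := vabs _ v in wu; have wa := wu.1.
have wD d : w (iota d)%:A <= 1.
  have [->|d0] := eqVneq d 0; first by rewrite rmorph0 scale0r av0.
  by rewrite vabs_le1 ?vD // -gpsi g0 psi0.
split=> x xs.
  have [|b Eb] := vres (beta x); first by rewrite mem_cat map_f.
  exists b; have [E|E] := eqVneq x (psi b ^+ k); [by left|right].
  have xb0 : g x - (iota b)%:A ^+ k != 0 by rewrite -gpsi -gX -gB g0 subr_eq0.
  have bw : w (beta x - (iota b)%:A) < 1.
    case: Eb => [->|]; first by rewrite subrr av0.
    move=> vb; have [->|nb] := eqVneq (beta x - (iota b)%:A) 0; first by rewrite av0.
    by rewrite vabs_lt1.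
  have bw1 : w (beta x) <= 1.
    by rewrite -(subrK (iota b)%:A (beta x)); apply: ultra_le => //; exact: ltW.
  rewrite gB gX gpsi.
  have : w (g x - (iota b)%:A ^+ k) < 1.
    rewrite -betaP // subrXX avM //.
    apply: le_lt_trans bw; rewrite ler_piMr ?av_ge0 //.
    apply: ultra_sum_le => // i _; rewrite (avM wa) !(avX wa).
    by apply: mulr_ile1; rewrite ?exprn_ge0 ?exprn_ile1 ?(av_ge0 wa) ?wD.
  by rewrite vabs_lt1.
move=> x0; have [|b Eb] := vres (g x)^-1.
  by rewrite mem_cat; apply/orP; right; apply/mapP; exists x.
have gx0 : g x != 0 by rewrite g0.
have : w (g x)^-1 <= 1.
  rewrite -(subrK (iota b)%:A (g x)^-1); apply: ultra_le => //.
  case: Eb => [->|vb]; first by rewrite subrr av0.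
  have [->|nb] := eqVneq ((g x)^-1 - (iota b)%:A) 0; first by rewrite av0.
  by rewrite vabs_le1 // ltW.
by rewrite vabs_le1 ?invr_eq0 // valuationV // oppr_ge0.
Qed.

End ResidueValuation.

(** * Prime ideals of the ring of S-integers *)

Lemma powR_compare1 (R : realType) (a s : R) : 0 <= a -> 0 < s ->
  (a `^ s < 1) = (a < 1) /\ (a `^ s <= 1) = (a <= 1).
Proof.
move=> a0 s0; have E : 1 `^ s = 1 by rewrite powR1.
have le x y : 0 <= x -> 0 <= y -> x <= y -> x `^ s <= y `^ s.
  by move=> x0 y0; apply: ge0_ler_powR; rewrite ?nnegrE // ltW.
have lt x y : 0 <= x -> 0 <= y -> x < y -> x `^ s < y `^ s.
  by move=> x0 y0; apply: gt0_ltr_powR; rewrite ?nnegrE.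
split; apply/idP/idP => [|a1].
- by apply: contraTT; rewrite -!leNgt => a1; rewrite -{1}E le.
- by rewrite -{1}E lt.
- by apply: contraTT; rewrite -!ltNge => a1; rewrite -{1}E lt.
- by rewrite -{1}E le.
Qed.

Section PlaceOfValuation.
Variables (R : realType) (K : fieldType).
Implicit Types (v : K -> int).

Definition place_of (c : R) v : set (K -> R) :=
  [set w | absolute_value w /\ equivalent (vabs c v) w].

(** The valuation chosen by [pord] induces the same place, so its absolute value
    is a positive power of c ^ v. *)
Lemma place_ofP c v : 0 < c < 1 -> normalized_valuation v ->
  [/\ place (place_of c v),
      forall x, x != 0 -> (0 <= pord (place_of c v) x) = (0 <= v x) &
      forall x, x != 0 -> (0 < pord (place_of c v) x) = (0 < v x)].
Proof.
move=> c01 vn; have wu := vabs_ultrametric c01 (normalized_valuationW vn).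
have wa := wu.1.
have [t t0 vt] : exists2 t, t != 0 & v t = 1 by case: vn => _ _ _ /(_ 1).
have pl : place (place_of c v).
  exists (vabs c v); split => //; exists t => //.
  by rewrite lt_eqF // vabs_lt1 // vt.
have [_ [c' c'01 [_ [s s0 E]]]] : normalized_valuation (pord (place_of c v)) /\
    induces (pord (place_of c v)) (place_of c v).
  apply: (@xgetPex _ (fun=> 0)
    [set v' | normalized_valuation v' /\ induces v' (place_of c v)]).
  by exists v; split => //; exists c => //; split => //; exact: equivalent_refl.
have cmp x := powR_compare1 (av_ge0 wa x) s0.
split=> // x x0.
  by rewrite -(vabs_le1 _ c'01) // -(vabs_le1 _ c01) // -(cmp x).2 -E.
by rewrite -(vabs_lt1 _ c'01) // -(vabs_lt1 _ c01) // -(cmp x).1 -E.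
Qed.
End PlaceOfValuation.

Section Assembly.
Variables (D : idomainType) (N : D -> nat) (k0 : fieldType).
Variables (iota : {rmorphism D -> k0}) (L : fieldExtType k0).
Variables (R : realType) (K : fieldType) (h : {rmorphism L -> K}).
Hypothesis normN : euclidean_norm N.
Hypothesis frac : fraction_map iota.
Hypothesis h_bij : bijective h.
Let psi : {rmorphism D -> K} := (h \o (in_alg L \o iota) : {rmorphism D -> K}).

Variable (S : set (set (K -> R))).
Hypothesis S_fin : finite_set S.
Hypothesis psi_S : forall d, psi d \in S_integer S.

Let psiA d : S_integers S := SInteger (psi_S d).

(** Take the product of elements d with B x d, over those x in s for which there
    is one. *)
Lemma common_multiple (T : eqType) (s : seq T) (B : T -> D -> Prop) :
  exists2 m, m != 0 & forall x, x \in s -> (exists2 d, d != 0 & B x d) ->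
    exists d, [/\ d != 0, B x d & divides d m].
Proof.
elim: s => [|x s [m m0 mP]]; first by exists 1 => //; exact: oner_neq0.
have [[d d0 Bd]|nB] := pselect (exists2 d, d != 0 & B x d).
  exists (d * m); first by rewrite mulf_neq0.
  move=> z; rewrite inE => /predU1P[->|/mP H] ez.
    by exists d; split => //; apply: dividesMr; exact: dividesrr.
  by have [d' [d'0 Bd' dm]] := H ez; exists d'; split => //; apply: dividesMl.
by exists m => // z; rewrite inE => /predU1P[->//|/mP H] ez; apply: H.
Qed.

(** If the set of suitable prime ideals were finite, let m1 be a multiple of a
    nonzero element of D in each of them, and m2 a multiple of an element of D
    of positive order at each place in S, whenever such elements exist.  A
    valuation v that vanishes at m1 m2 and is positive at pi in D then defines
    a place outside S, and a suitable prime ideal not in the finite set: if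
    they belonged to these sets, then pi would show that m1 or m2 has a factor
    of positive value. *)
Lemma infinite_permutation_chains (k m : nat) (r : 'I_m -> S_integers S) :
  (0 < k)%N ->
  (forall s : 'S_m, forall i j i' j' : 'I_m, (i <= j)%N -> (i' <= j')%N ->
     segment_sum (r \o s) i j = segment_sum (r \o s) i' j' ->
     (i, j) = (i', j')) ->
  infinite_set [set P : set (S_integers S) |
    nonzero_prime_ideal P /\ permutation_chain P k r].
Proof.
move=> k_gt0 r_dist fin.
have /finite_seqP[good goodE] := fin.
have /finite_seqP[sS sSE] := S_fin.
have [m1 m10 m1P] := common_multiple good (fun P d => P (psiA d)).
have [m2 m20 m2P] := common_multiple sS (fun Q d => 0 < pord Q (psi d)).
have m0 : m1 * m2 != 0 by rewrite mulf_neq0.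
pose T : finType := ('S_m * ('I_m * 'I_m))%type.
pose f (t : T) : K := \val (segment_sum (r \o t.1) t.2.1 t.2.2).
pose sums := [seq f t | t : T].
pose diffs := [seq x.1 - x.2 | x <- allpairs pair sums sums].
have [v [vv vD vm [pi pi0 vpi] [vsums vdiffs]]] :=
  valuation_with_residues normN frac h_bij R sums diffs k_gt0 m0.
have psi_inj d : d != 0 -> psi d != 0.
  by move=> d0; rewrite !fmorph_eq0 -(rmorph0 iota) (inj_eq frac.1).
have vdvd d : d != 0 -> divides d (m1 * m2) -> v (psi d) = 0.
  move=> d0 [e E]; have e0 : e != 0 by apply: contraNneq m0 => e0; rewrite E e0 mul0r.
  have := vm; rewrite -[h _]/(psi _) E rmorphM valuationM ?psi_inj // => E'.
  have := vD d d0; have := vD e e0; rewrite -![h _]/(psi _) => h1 h2; lia.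
have [v' [nv' [e e0 vE]]] := normalize_valuation vv (psi_inj _ pi0) vpi.
have c01 : 0 < (2^-1 : R) < 1 by lra.
have [pQ ge0 gt0] := place_ofP c01 nv'; set Q := place_of _ _ in pQ ge0 gt0.
have vge x : x != 0 -> (0 <= v x) = (0 <= v' x) by move=> x0; rewrite vE // pmulr_rge0.
have vgt x : x != 0 -> (0 < v x) = (0 < v' x) by move=> x0; rewrite vE // pmulr_rgt0.
have nSQ : ~ S Q.
  rewrite sSE /= => QS.
  have [|d [d0 dQ dm]] := m2P Q QS.
    by exists pi => //; rewrite gt0 ?psi_inj // -vgt ?psi_inj.
  move: dQ; rewrite gt0 ?psi_inj // -vgt ?psi_inj // vdvd ?ltxx //.
  exact: dividesMl.
have wu := vabs_ultrametric c01 vv; set w := vabs _ v in wu; have wa := wu.1.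
have wA (a : S_integers S) : w (\val a) <= 1.
  have [->|a0] := eqVneq (\val a) 0; first by rewrite av0.
  rewrite vabs_le1 // vge // -ge0 //.
  by have /asboolP := valP a; apply.
pose P : set (S_integers S) := [set a | w (\val a) < 1].
have Ppi : P (psiA pi) by rewrite /P /= vabs_lt1 ?psi_inj.
have inP x : (x \in [in P]) = (w (\val x) < 1).
  by apply/idP/idP => [/set_mem//|wx]; exact: mem_set.
have Pgood : nonzero_prime_ideal P /\ permutation_chain P k r.
  split; first split.
  - split.
    + by rewrite inP av0.
    + by rewrite inP av1 // ltxx.
    + move=> a x z; rewrite !inP => wx wz.
      apply: ultra_lt => //; rewrite avM //.
      by apply: le_lt_trans wx; rewrite ler_piMl ?av_ge0.
  - move=> x z; rewrite !inP avM // => xz.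
    have [//|x1] := ltP (w (\val x)) 1.
    have [|z1] := ltP (w (\val z)) 1; first by rewrite orbT.
    by move: xz; rewrite ltNge mulr_ege1.
  - move=> P0; have : [set 0] (psiA pi) by rewrite -P0.
    by move=> /(congr1 val) /=; apply/eqP/psi_inj.
  have fP (t : T) : exists b, P (segment_sum (r \o t.1) t.2.1 t.2.2 - b ^+ k).
    have [|b bE] := vsums (f t); first by apply: map_f; rewrite mem_enum.
    exists (psiA b).
    suff : w (\val (segment_sum (r \o t.1) t.2.1 t.2.2 - psiA b ^+ k)) < 1 by [].
    have -> : \val (segment_sum (r \o t.1) t.2.1 t.2.2 - psiA b ^+ k) = f t - psi b ^+ k.
      by rewrite rmorphB rmorphXn.
    have [->|n0] := eqVneq (f t - psi b ^+ k) 0; first by rewrite av0.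
    rewrite vabs_lt1 //; case: bE => // bE.
    by move: n0; rewrite subr_eq0 -bE eqxx.
  move=> s; split => [i j _|i j i' j' ij i'j' Pd].
    exact: (fP (s, (i, j))).
  apply: contrapT => ne.
  have : w (f (s, (i, j)) - f (s, (i', j'))) < 1 by [].
  have d0 : f (s, (i, j)) - f (s, (i', j')) != 0.
    rewrite subr_eq0; apply/eqP => /val_inj E; apply: ne; exact: r_dist E.
  rewrite vabs_lt1 // ltNge vdiffs //.
  apply/mapP; exists (f (s, (i, j)), f (s, (i', j'))) => //.
  by apply: allpairs_f; apply: map_f; rewrite mem_enum.
have Pg : P \in good by move: Pgood; rewrite -[X in X -> _]/([set P | _] P) goodE.
have [|d [d0 Pd dm]] := m1P P Pg; first by exists pi.
move: Pd; rewrite /P /= vabs_lt1 ?psi_inj // vdvd ?ltxx //.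
exact: dividesMr.
Qed.

End Assembly.

(** * The theorem *)

(** An element y with a pole at a place P of S is transcendental, since an
    absolute value is trivial on elements algebraic over a finite field; so
    [exists_pole_only_at] applies to it. *)
Lemma nonconstant_S_integer (R : realType) (F : finFieldType) (K : fieldType)
    (phi : {rmorphism F -> K}) t (S : set (set (K -> R))) :
  finite_over phi t -> (forall P, S P -> place P) -> S !=set0 ->
  exists2 x, transcendental phi x & x \in S_integer S.
Proof.
move=> tfin S_place [P SP]; have pP := S_place P SP.
have [u Pu] : exists u, P u.
  by case: pP => u [ua _ ->]; exists u; split => //; exact: equivalent_refl.
have [y y0 uy] := place_exists_gt1 pP Pu.
have ua := place_absolute_value pP Pu; have uu := av_nonarchimedean phi ua.
have ytr : transcendental phi y.
  move=> /integral_algebraic yint; move: uy; apply/negP; rewrite -leNgt.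
  by apply: (ultra_integral uu _ yint) => c; exact: av_finite_le1.
have yfin := finite_over_transcendental tfin ytr.
have [x xtr xP] := exists_pole_only_at yfin pP Pu uy.
exists x => //; apply/asboolP => Q pQ SQ; apply: xP => // QP.
by apply: SQ; rewrite QP.
Qed.

Lemma constant_S_integer (R : realType) (F : finFieldType) (K : fieldType)
    (phi : {rmorphism F -> K}) (S : set (set (K -> R))) c : phi c \in S_integer S.
Proof.
apply/asboolP => Q pQ _; have [->//|[nQ [d d01 Qw]]] := pord_cases Q.
have [->|c0] := eqVneq (phi c) 0; first by rewrite pord0.
have wa := (vabs_ultrametric d01 (normalized_valuationW nQ)).1.
by rewrite -(@vabs_le1 R K d) // av_finite_le1.
Qed.

Theorem theorem1p2 (R : realType) (K : fieldType) (S : set (set (K -> R)))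
    (k m : nat) (r : 'I_m -> S_integers S) :
  global_field K ->
  (forall P, S P -> place P) ->
  finite_set S ->
  S !=set0 ->
  (number_field K -> forall P, place P -> archimedean P -> S P) ->
  (0 < k)%N ->
  (0 < m)%N ->
  (forall s : 'S_m, forall i j i' j' : 'I_m, (i <= j)%N -> (i' <= j')%N ->
     segment_sum (r \o s) i j = segment_sum (r \o s) i' j' ->
     (i, j) = (i', j')) ->
  infinite_set [set P : set (S_integers S) |
    nonzero_prime_ideal P /\ permutation_chain P k r].
Proof.
move=> gK S_place S_fin S_ne _ k0 _ r_dist.
case: gK => [[L [f f_bij]]|[F [L [f f_bij]]]].
  apply: (infinite_permutation_chains int_euclidean_norm
            (iota := (intr : {rmorphism int -> rat})) intr_fraction_map f_bij) => //.
  by move=> d; rewrite -[X in X \in _]/(f (in_alg L d%:~R)) !rmorph_int rpred_int.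
pose phi : {rmorphism F -> K} :=
  (f \o (in_alg L \o (@FracField.tofrac {poly F} \o polyC)) : {rmorphism F -> K}).
pose t := f (FracField.tofrac 'X)%:A.
have tfin : finite_over phi t.
  exists (f \o in_alg L : {rmorphism _ -> K}), L, f; split => // g.
  pose chi : {rmorphism {poly F} -> K} := (f \o (in_alg L \o @FracField.tofrac {poly F})).
  rewrite -[LHS]/(chi g) -eval_atE.
  elim/poly_ind: g => [|g c IHg]; first by rewrite !rmorph0.
  rewrite !rmorphD !rmorphM IHg; congr (_ * _ + _).
    by rewrite eval_atE map_polyX hornerX.
  by rewrite eval_atE map_polyC hornerC.
have [x xtr xS] := nonconstant_S_integer tfin S_place S_ne.
have [xi [L' [h [h_bij hA xiE]]]] := finite_over_transcendental tfin xtr.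
apply: (infinite_permutation_chains (poly_euclidean_norm F)
          (iota := (@FracField.tofrac {poly F} : {rmorphism _ -> _}))
          (tofrac_fraction_map _) h_bij) => //.
move=> g; rewrite /= hA xiE horner_coef.
apply: rpred_sum => i _; rewrite coef_map; apply: rpredM.
  exact: constant_S_integer.
exact: rpredX.
Qed.
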